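(* There is a surjective algebra homomorphism $$\widetilde{\mathcal A}\otimes_{\mathbb Z[q_1^{\pm1},q_2^{\pm1}]}\mathbb Z[q^{\pm1}]\ \longrightarrow\ \bigoplus_{n\ge0}\operatorname{Tr}(\mathrm{AH}_n),$$ where $\mathbb Z[q_1^{\pm1},q_2^{\pm1}]\to\mathbb Z[q^{\pm1}]$ is $q_1\mapsto q^{-2}$, $q_2\mapsto q^2$, the target carries the skein product, and the homomorphism sends each generator $\mathscr E_{(d_1,\dots,d_n)}$ to $q^{1-n}\,[Y_1^{d_1}\cdots Y_n^{d_n}T_1\cdots T_{n-1}]\in\operatorname{Tr}(\mathrm{AH}_n)$.
   Context: Extended affine braid group $\mathrm{ABr}_n$: generators $\sigma_0,\dots,\sigma_{n-1},\omega$ (indices mod $n$), relations $\sigma_i\sigma_{i+1}\sigma_i=\sigma_{i+1}\sigma_i\sigma_{i+1}$, $\sigma_i\sigma_j=\sigma_j\sigma_i$ ($|i-j|>1$ mod $n$), $\omega\sigma_i\omega^{-1}=\sigma_{i+1}$; $y_i=\sigma_{i-1}^{-1}\cdots\sigma_1^{-1}\omega\sigma_{n-1}\cdots\sigma_i$ ($1\le i\le n$), pairwise commuting. The extended affine Hecke algebra $\mathrm{AH}_n$ is the quotient of the group algebra $\mathbb Z[q^{\pm1}][\mathrm{ABr}_n]$ by $(T_i-q)(T_i+q^{-1})=0$ for all $i\in\mathbb Z/n$, where $T_i,\Omega,Y_i$ denote the images of $\sigma_i,\omega,y_i$. Its cocenter is $\operatorname{Tr}(\mathrm{AH}_n)=\mathrm{AH}_n/[\mathrm{AH}_n,\mathrm{AH}_n]$,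 with $[x]$ the class of $x$; $\operatorname{Tr}(\mathrm{AH}_0)=\mathbb Z[q^{\pm1}]$. The skein product $\operatorname{Tr}(\mathrm{AH}_n)\otimes\operatorname{Tr}(\mathrm{AH}_k)\to\operatorname{Tr}(\mathrm{AH}_{n+k})$ is induced by the group homomorphism $\mathrm{ABr}_n\times\mathrm{ABr}_k\to\mathrm{ABr}_{n+k}$ sending $\sigma_i,y_i$ of the first factor to $\sigma_i,y_i$ and $\sigma_j,y_j$ of the second factor to $\sigma_{j+n},y_{j+n}$. The algebra $\widetilde{\mathcal A}$ is the $\mathbb Z[q_1^{\pm1},q_2^{\pm1}]$-algebra generated by symbols $\mathscr E_{(d_1,\dots,d_n)}$ ($n\ge1$, $d_i\in\mathbb Z$) subject to: for all $d_1,\dots,d_n$ and $1\le i\le n-1$, $\mathscr E_{(d_1,\dots,d_i,d_{i+1},\dots,d_n)}-q_1q_2\,\mathscr E_{(d_1,\dots,d_i-1,d_{i+1}+1,\dots,d_n)}=(1-q_1)\,\mathscr E_{(d_1,\dots,d_i)}\mathscr E_{(d_{i+1},\dots,d_n)}$; and for all $d_1,\dots,d_n,k\in\mathbb Z$, $[\mathscr E_{(k)},\mathscr E_{(d_1,\dots,d_n)}]=(q_2-1)\sum_{i=1}^n c_i$, where $c_i=\sum_{a=1}^{k-d_i}\mathscr E_{(d_1,\dots,d_{i-1},k-a,d_i+a,d_{i+1},\dots,d_n)}$ if $k\ge d_i$ and $c_i=-\sum_{a=1}^{d_i-k}\mathscr E_{(d_1,\dots,d_{i-1},d_i-a,k+a,d_{i+1},\dots,d_n)}$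 if $k\le d_i$.
   Formalization: For n = 1 the group ABr_1 is taken to be generated by ω alone (no σ_0, since otherwise T_0 is not in the image), and for n = 2 no braid relation between σ_0 and σ_1 is imposed (otherwise the skein product is not defined). *)

(* Defs.v *)
From HB Require Import structures.
From mathcomp Require Import all_boot all_algebra.
From mathcomp Require Import finmap monalg.
From Stdlib Require List.
Set Implicit Arguments.
Unset Strict Implicit.
Unset Printing Implicit Defensive.
Import GRing.Theory.
Local Open Scope ring_scope.

Definition zspan (V : zmodType) (S : V -> Prop) (x : V) : Prop :=
  exists l : seq (int * V),
    (forall p, Stdlib.Lists.List.In p l -> S p.2) /\ x = \sum_(p <- l) p.2 *~ p.1.

Definition lcomb (T : Type) := seq (int * seq T).

Definition fdiff (T : Type) (u v : seq T) : lcomb T := [:: (1, u); (-1, v)].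

Definition sandwich (T : Type) (a : seq T) (r : lcomb T) (b : seq T) : lcomb T :=
  [seq (p.1, a ++ p.2 ++ b) | p <- r].

(* Letters for words in AH_n (as a Z-algebra):
   Sg i = T_i, Sgi i = T_i^{-1}, Om = Omega, Omi = Omega^{-1},
   Qb = q, Qbi = q^{-1}. *)
Inductive BG := Sg of nat | Sgi of nat | Om | Omi | Qb | Qbi.

Definition BG_enc (x : BG) : (bool * nat) + (bool * bool) :=
  match x with
  | Sg i => inl (false, i) | Sgi i => inl (true, i)
  | Om => inr (false, false) | Omi => inr (false, true)
  | Qb => inr (true, false) | Qbi => inr (true, true)
  end.
Definition BG_dec (y : (bool * nat) + (bool * bool)) : BG :=
  match y with
  | inl (false, i) => Sg i | inl (true, i) => Sgi i
  | inr (false, false) => Om | inr (false, true) => Omi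
  | inr (true, false) => Qb | inr (true, true) => Qbi
  end.
Lemma BG_encK : cancel BG_enc BG_dec. Proof. by case. Qed.
HB.instance Definition _ := Countable.copy BG (can_type BG_encK).

(* Letters allowed in AH_n.  Convention: q^{+-1} always;
   Omega^{+-1} for n >= 1; T_i^{+-1}, i in Z/n = {0..n-1}, for n >= 2. *)
Definition validl (n : nat) (x : BG) : bool :=
  match x with
  | Sg i | Sgi i => (2 <= n)%N && (i < n)%N
  | Om | Omi => (0 < n)%N
  | Qb | Qbi => true
  end.
Definition valid (n : nat) (w : seq BG) : bool := all (validl n) w.

Definition far (n i j : nat) : bool :=
  let d := ((i + n - j) %% n)%N in [&& d != 0%N, d != 1%N & d != n.-1].

(* (T_i - q)(T_i + q^{-1}) expanded *)
Definition hecke (i : nat) : lcomb BG :=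
  [:: (1, [:: Sg i; Sg i]); (1, [:: Sg i; Qbi]);
      (-1, [:: Qb; Sg i]); (-1, [:: Qb; Qbi])].

(* Defining relations of AH_n as a Z-algebra: Z[q^{+-1}] central,
   the group algebra of ABr_n (inverses + braid-group relations),
   and the Hecke relations. *)
Definition RelB (n : nat) (r : lcomb BG) : Prop :=
  (exists x, validl n x /\ r = fdiff [:: Qb; x] [:: x; Qb])
  \/ (exists x, validl n x /\ r = fdiff [:: Qbi; x] [:: x; Qbi])
  \/ r = fdiff [:: Qb; Qbi] [::] \/ r = fdiff [:: Qbi; Qb] [::]
  \/ ((0 < n)%N /\ (r = fdiff [:: Om; Omi] [::] \/ r = fdiff [:: Omi; Om] [::]))
  \/ (exists i, [/\ (2 <= n)%N, (i < n)%N &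
        (r = fdiff [:: Sg i; Sgi i] [::] \/ r = fdiff [:: Sgi i; Sg i] [::])])
  \/ (exists i, [/\ (3 <= n)%N, (i < n)%N &
        r = fdiff [:: Sg i; Sg (i.+1 %% n); Sg i]
                  [:: Sg (i.+1 %% n); Sg i; Sg (i.+1 %% n)]])
  \/ (exists i j, [/\ (2 <= n)%N, (i < n)%N, (j < n)%N, far n i j &
        r = fdiff [:: Sg i; Sg j] [:: Sg j; Sg i]])
  \/ (exists i, [/\ (2 <= n)%N, (i < n)%N &
        r = fdiff [:: Om; Sg i; Omi] [:: Sg (i.+1 %% n)]])
  \/ (exists i, [/\ (2 <= n)%N, (i < n)%N & r = hecke i]).

(* Representatives: the free Z-module on degree-tagged words (n, w);
   (n, w) stands for the word w in AH_n. *)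
Definition FB := {malg int[(nat * seq BG)%type]}.

Definition wB (n : nat) (w : seq BG) : FB := mkmalgU (n, w) 1.

Definition lcB (n : nat) (r : lcomb BG) : FB :=
  \sum_(p <- r) mkmalgU (n, p.2) p.1.

(* Generators of the kernel of FB ->> (+)_n Tr(AH_n):
   words with letters not in AH_n, the two-sided ideals of relations of each
   AH_n, and the commutators ab - ba in each AH_n. *)
Definition GenKerB (y : FB) : Prop :=
  (exists n w, ~~ valid n w /\ y = wB n w)
  \/ (exists n a r b, RelB n r /\ y = lcB n (sandwich a r b))
  \/ (exists n a b, y = wB n (a ++ b) - wB n (b ++ a)).

Definition eqB (x y : FB) : Prop := zspan GenKerB (x - y).

(* y_i = s_{i-1}^{-1}...s_1^{-1} w s_{N-1}...s_i in ABr_N, and its inverse *)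
Definition ywd (N i : nat) : seq BG :=
  [seq Sgi j | j <- rev (iota 1 (i - 1))] ++
  Om :: [seq Sg j | j <- rev (iota i (N - i))].
Definition ywdinv (N i : nat) : seq BG :=
  [seq Sgi j | j <- iota i (N - i)] ++
  Omi :: [seq Sg j | j <- iota 1 (i - 1)].

(* The homomorphism ABr_n x ABr_k -> ABr_N (N = n + k), sigma_i,y_i |-> sigma_i,y_i
   (first factor), sigma_j,y_j |-> sigma_{j+n},y_{j+n} (second factor),
   written on the generators sigma_0..sigma_{n-1}, omega (and q |-> q):
   omega_n |-> y_1 s_1^{-1}...s_{n-1}^{-1},  sigma_0 |-> omega sigma_{n-1} omega^{-1},
   omega_k |-> y_{n+1} s_{n+1}^{-1}...s_{N-1}^{-1}, sigma_0 |-> omega sigma_{k-1} omega^{-1}. *)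
Definition om1 (n N : nat) : seq BG :=
  ywd N 1 ++ [seq Sgi j | j <- iota 1 (n - 1)].
Definition om1i (n N : nat) : seq BG :=
  [seq Sg j | j <- rev (iota 1 (n - 1))] ++ ywdinv N 1.
Definition om2 (n N : nat) : seq BG :=
  ywd N n.+1 ++ [seq Sgi j | j <- iota n.+1 (N - n.+1)].
Definition om2i (n N : nat) : seq BG :=
  [seq Sg j | j <- rev (iota n.+1 (N - n.+1))] ++ ywdinv N n.+1.

Definition iota1 (n N : nat) (x : BG) : seq BG :=
  match x with
  | Sg i => if i == 0%N then om1 n N ++ Sg n.-1 :: om1i n N else [:: Sg i]
  | Sgi i => if i == 0%N then om1 n N ++ Sgi n.-1 :: om1i n N else [:: Sgi i]
  | Om => om1 n N | Omi => om1i n N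
  | Qb => [:: Qb] | Qbi => [:: Qbi]
  end.
Definition iota2 (n N : nat) (x : BG) : seq BG :=
  match x with
  | Sg j => if j == 0%N then om2 n N ++ Sg N.-1 :: om2i n N else [:: Sg (j + n)]
  | Sgi j => if j == 0%N then om2 n N ++ Sgi N.-1 :: om2i n N else [:: Sgi (j + n)]
  | Om => om2 n N | Omi => om2i n N
  | Qb => [:: Qb] | Qbi => [:: Qbi]
  end.

(* skein product of two basis words (invalid words represent 0) *)
Definition skeinW (u v : nat * seq BG) : FB :=
  let N := (u.1 + v.1)%N in
  if valid u.1 u.2 && valid v.1 v.2 then
    wB N (flatten [seq iota1 u.1 N x | x <- u.2] ++
          flatten [seq iota2 u.1 N x | x <- v.2])
  else 0.

Definition prodB (x y : FB) : FB :=
  \sum_(u <- msupp x) \sum_(v <- msupp y) skeinW u v *~ (x@_u * y@_v).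

Definition oneB : FB := wB 0 [::].

Definition ypow (n i : nat) (z : int) : seq BG :=
  if (0 <= z)%R then flatten (nseq `|z|%N (ywd n i))
  else flatten (nseq `|z|%N (ywdinv n i)).

(* q^{1-n} Y_1^{d_1} ... Y_n^{d_n} T_1 ... T_{n-1}  (n = size d >= 1) *)
Definition eword (d : seq int) : seq BG :=
  let n := size d in
  nseq n.-1 Qbi ++ flatten [seq ypow n i.+1 (nth 0 d i) | i <- iota 0 n]
  ++ [seq Sg j | j <- iota 1 n.-1].

Definition eB (d : seq int) : FB := wB (size d) (eword d).

(* Letters: E d0 ds = script E_{(d0, ds...)}, Qa = q, Qai = q^{-1}. *)
Inductive AG := E of int & seq int | Qa | Qai.

Definition AG_enc (x : AG) : (int * seq int) + bool :=
  match x with E d0 ds => inl (d0, ds) | Qa => inr false | Qai => inr true end.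
Definition AG_dec (y : (int * seq int) + bool) : AG :=
  match y with inl (d0, ds) => E d0 ds | inr false => Qa | inr true => Qai end.
Lemma AG_encK : cancel AG_enc AG_dec. Proof. by case. Qed.
HB.instance Definition _ := Countable.copy AG (can_type AG_encK).

Definition Ew (d : seq int) : seq AG :=
  match d with [::] => [::] | d0 :: ds => [:: E d0 ds] end.

(* images of q1, q2 under q1 |-> q^{-2}, q2 |-> q^2 *)
Definition q1w : seq AG := [:: Qai; Qai].
Definition q2w : seq AG := [:: Qa; Qa].

(* first family:  E_d - q1 q2 E_{d'} - (1 - q1) E_{d<=i} E_{d>i},  1 <= i <= n-1 *)
Definition dshift (d : seq int) (i : nat) : seq int :=
  set_nth 0 (set_nth 0 d i.-1 (nth 0 d i.-1 - 1)) i (nth 0 d i + 1).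
Definition rel1 (d : seq int) (i : nat) : lcomb AG :=
  [:: (1, Ew d); (-1, q1w ++ q2w ++ Ew (dshift d i));
      (-1, Ew (take i d) ++ Ew (drop i d));
      (1, q1w ++ Ew (take i d) ++ Ew (drop i d))].

(* the terms of c_i (0-based index j), as (sign, index sequence) *)
Definition cterms (k : int) (d : seq int) (j : nat) : seq (int * seq int) :=
  let dj := nth 0 d j in
  if (dj <= k)%R then
    [seq (1, take j d ++ [:: k - a%:Z; dj + a%:Z] ++ drop j.+1 d)
    | a <- iota 1 `|k - dj|%N]
  else
    [seq (-1, take j d ++ [:: dj - a%:Z; k + a%:Z] ++ drop j.+1 d)
    | a <- iota 1 `|dj - k|%N].

(* second family:  [E_(k), E_d] - (q2 - 1) sum_i c_i *)
Definition rel2 (k : int) (d : seq int) : lcomb AG :=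
  (1, E k [::] :: Ew d) :: (-1, Ew d ++ [:: E k [::]]) ::
  flatten [seq [:: (- p.1, q2w ++ Ew p.2); (p.1, Ew p.2)]
          | p <- flatten [seq cterms k d j | j <- iota 0 (size d)]].

Definition RelA (r : lcomb AG) : Prop :=
  (exists d i, (0 < i < size d)%N /\ r = rel1 d i)
  \/ (exists k d, (0 < size d)%N /\ r = rel2 k d)
  \/ (exists x, r = fdiff [:: Qa; x] [:: x; Qa])
  \/ (exists x, r = fdiff [:: Qai; x] [:: x; Qai])
  \/ r = fdiff [:: Qa; Qai] [::] \/ r = fdiff [:: Qai; Qa] [::].

(* free Z-algebra on the letters AG (basis: words) *)
Definition FA := {malg int[seq AG]}.

Definition wA (w : seq AG) : FA := mkmalgU w 1.

Definition lcA (r : lcomb AG) : FA := \sum_(p <- r) mkmalgU p.2 p.1.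

Definition prodA (x y : FA) : FA :=
  \sum_(u <- msupp x) \sum_(v <- msupp y) mkmalgU (u ++ v) (x@_u * y@_v).

Definition oneA : FA := wA [::].

Definition GenKerA (y : FA) : Prop :=
  exists a r b, RelA r /\ y = lcA (sandwich a r b).

Definition eqA (x y : FA) : Prop := zspan GenKerA (x - y).

(* Main.v *)
(** The image of a word [E_(d^1) ... E_(d^r)] is written down directly, as
    [q^e [Y^D T_J]] with [D] the concatenation of the [d^i] and [T_J] the product
    of the [T_j] inside the blocks; multiplicativity then only needs that the two
    block embeddings send [y_i] to [y_i] and to [y_(n+i)].

    First relation: [T_i - T_i^-1 = q - q^-1], and [Y_(i+1) T_i = T_i^-1 Y_i] lets
    cyclicity turn the [T_i^-1] term into the shifted monomial.

    Second relation: push the strand carrying [Y^k] through the Coxeter element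
    [c] one strand at a time.  With [A_j] the class where it sits in position
    [j + 1], Bernstein's relation and [T_(j+1) c = c T_j] give
    [A_j = A_(j+1) + (q - q^-1) c_(j+1)], and the sum telescopes.

    Surjectivity: every element is a combination of [Y^D h] with [h] in the finite
    Hecke algebra, and [H_(m+1) = H_m + H_m T_m H_m].  In [[Y^D a T_m b T_J]] with
    [a, b] in [H_m] and [J > m], cyclicity moves [b] to the front, where it is
    absorbed; descending on [m] leaves only the [[Y^D T_J]]. *)
Require Import Defs.
From HB Require Import structures.
From mathcomp Require Import all_boot all_order all_algebra.
From mathcomp Require Import finmap monalg zify.
From mathcomp Require Import ring_quotient generic_quotient.
From Stdlib Require Import ClassicalEpsilon.
Set Implicit Arguments.
Unset Strict Implicit.
Unset Printing Implicit Defensive.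
Import Order.TTheory GRing.Theory Num.Theory.
Local Open Scope ring_scope.
Local Open Scope quotient_scope.

(** * The Bernstein relation *)

(** The commutation of the y_i is not among the relations in [RelB], so it has to be derived from
    the braid relations and the action of omega before any monomial Y^D makes sense. Computations
    take place in an arbitrary ring [A] with an evaluation [ev] of the letters that satisfies
    [RelB].

    A relation of the source must hold between arbitrary words a and b, and the map is defined on
    whole words. The trace identities are therefore proved with the neighbouring blocks present: a
    central factor [C] collects all powers of q, and lists of indices hold the letters T_j of the
    other blocks.

    The normalisation q^(1-n) is what makes the coefficients fit. Under the specialisation q1 q2 =
    1, and once the powers of q of all blocks are collected both 1 - q1 and q2 - 1 become q - q^-1,
    the coefficient in T_i = T_i^-1 + (q - q^-1). Since q is itself a letter, traces are merely
    additive and powers of q are carried along explicitly. *)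

Section Commutation.
Variable A : pzRingType.
Implicit Types (x y a b : A) (k l : int).

Lemma comm_inv a x xi : x * xi = 1 -> xi * x = 1 ->
  GRing.comm a x -> GRing.comm a xi.
Proof.
move=> xK Kx cax; rewrite /GRing.comm -[LHS]mul1r -Kx -mulrA (mulrA x).
by rewrite -cax -(mulrA a) xK mulr1.
Qed.

Lemma comm_bigprod (I : Type) (r : seq I) (P : pred I) (f : I -> A) a :
  (forall i, P i -> GRing.comm a (f i)) -> all P r ->
  GRing.comm a (\prod_(i <- r) f i).
Proof.
move=> cf; elim: r => [|i r IHr] /=; first by rewrite big_nil => _; exact: commr1.
by case/andP=> Pi Pr; rewrite big_cons; apply: commrM; [exact: cf | exact: IHr].
Qed.

(** The inverse [xi] is passed explicitly because [A] is an arbitrary ring. The sign test is that of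
    [ypow], so [evw_ypow] matches branch by branch. *)
Definition zpow x xi k := if 0 <= k then x ^+ `|k|%N else xi ^+ `|k|%N.

Lemma zpow0 x xi : zpow x xi 0 = 1. Proof. by []. Qed.

Lemma comm_zpow a x xi k :
  GRing.comm a x -> GRing.comm a xi -> GRing.comm a (zpow x xi k).
Proof. by rewrite /zpow => *; case: ifP => _; apply: commrX. Qed.

Section Zpow.
Variables x xi : A.
Hypotheses (xK : x * xi = 1) (Kx : xi * x = 1).

Lemma zpowS k : zpow x xi (k + 1) = x * zpow x xi k.
Proof.
case: k => [m|[|m]]; rewrite /zpow.
- by rewrite [0 <= _]/= (_ : `|_|%N = m.+1) ?exprS //; lia.
- by rewrite /= xK.
- by rewrite /= [in RHS](exprS _ m.+1) mulrA xK mul1r subn1.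
Qed.

Lemma zpowP k : zpow x xi (k - 1) = xi * zpow x xi k.
Proof. by rewrite -{2}[k](subrK 1) zpowS mulrA Kx mul1r. Qed.

End Zpow.

(* When [k >= l] this is the divided difference [b (a^k b^l - a^l b^k) / (a - b)]. *)
Definition ladder a ai b bi k l :=
  \sum_(i <- iota 1 `|k - l|%N)
    zpow a ai (k - i%:Z) * zpow b bi (l + i%:Z).

(** The two branches have the signs and ranges of the sum c_i in the second relation. *)
Definition dd a ai b bi k l :=
  if l <= k then ladder a ai b bi k l else - ladder a ai b bi l k.

Section TwoStrands.
(** Here [a], [b] model y_i, y_(i+1), while [t], [s] model T_i and its inverse, and [z] models q -
    q^-1. *)
Variables (a ai b bi t s z : A).
Hypotheses (aK : a * ai = 1) (Ka : ai * a = 1) (bK : b * bi = 1) (Kb : bi * b = 1).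
Hypotheses (tK : t * s = 1) (Kt : s * t = 1) (tE : t = s + z).
Hypotheses (ab : a * b = b * a) (bE : b = s * a * s).
Hypotheses (za : GRing.comm z a) (zb : GRing.comm z b).

Lemma zpow_two_comm k l : GRing.comm (zpow b bi k) (zpow a ai l).
Proof.
have cb_ai : GRing.comm b ai by apply: comm_inv aK Ka _; exact/esym.
apply: comm_zpow; apply: commr_sym; apply: comm_zpow => //.
- exact: comm_inv bK Kb ab.
- exact: comm_inv bK Kb (esym cb_ai).
Qed.

Lemma cross_a : a * s = s * b + z * b.
Proof. by rewrite -mulrDl -tE bE !mulrA tK mul1r. Qed.

Lemma cross_b : b * s = s * a - z * b.
Proof.
have -> : s * a = b * t by rewrite bE -mulrA Kt mulr1.
by rewrite tE mulrDr zb addrK.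
Qed.

(** Both a b t and t b a collapse to a s a, so a b commutes with [t] and hence with [s]; the element
    in question is a power of a b. *)
Lemma comm_diag k : GRing.comm s (zpow a ai k * zpow b bi k).
Proof.
have sab : GRing.comm s (a * b).
  apply: commr_sym; apply: comm_inv tK Kt _; rewrite /GRing.comm [in RHS]ab bE.
  by rewrite !mulrA tK mul1r -mulrA Kt mulr1.
have sba : GRing.comm s (bi * ai).
  apply: comm_inv sab.
  - by rewrite mulrA -(mulrA a) bK mulr1.
  - by rewrite mulrA -(mulrA bi) Ka mulr1.
have bia : GRing.comm bi ai.
  by apply: comm_inv aK Ka _; apply: commr_sym; apply: comm_inv bK Kb _.
elim/int_rect: k => [|m IH|m IH].
- by rewrite !zpow0 mulr1; exact: commr1.
- rewrite -addn1 PoszD !zpowS // mulrA -(mulrA a) -(zpow_two_comm 1 m).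
  rewrite !mulrA -(mulrA (a * _)). by apply: commrM.
- rewrite -addn1 PoszD opprD !zpowP // mulrA -(mulrA ai) -(zpow_two_comm (-1) (-m%:Z)).
  rewrite !mulrA -bia -(mulrA (bi * _)). by apply: commrM.
Qed.

(** This recursion splits off the last term and factors out [a], while [ladderSr] splits off the
    first term and factors out [b]. They match the inductions of [cross_ge] and [cross_le], which
    multiply by [a] and by [b]. *)
Lemma ladderSl l (m : nat) :
  ladder a ai b bi (l + m%:Z + 1) l =
  zpow a ai l * zpow b bi (l + m%:Z + 1) + a * ladder a ai b bi (l + m%:Z) l.
Proof.
rewrite /ladder (_ : `|_ - _|%N = m.+1); last by lia.
rewrite (_ : `|(l + m%:Z)%R - l|%N = m); last by lia.
rewrite -[m.+1]addn1 iotaD big_cat big_seq1 /= [LHS]addrC; congr (_ + _).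
  by congr (zpow _ _ _ * zpow _ _ _); lia.
rewrite big_distrr /=; apply: eq_bigr => i _; rewrite mulrA -zpowS //.
by congr (zpow _ _ _ * _); lia.
Qed.

Lemma ladderSr l (m : nat) :
  ladder a ai b bi (l + m%:Z + 1) l =
  zpow a ai (l + m%:Z) * zpow b bi (l + 1) + b * ladder a ai b bi (l + m%:Z) l.
Proof.
rewrite /ladder (_ : `|_ - _|%N = m.+1); last by lia.
rewrite (_ : `|(l + m%:Z)%R - l|%N = m); last by lia.
rewrite /= big_cons; congr (_ + _).
  by congr (zpow _ _ _ * zpow _ _ _); lia.
rewrite (iotaDl 1 1) big_map big_distrr /=; apply: eq_bigr => i _.
rewrite mulrA (zpow_two_comm 1) -mulrA -zpowS //.
by congr (zpow _ _ _ * zpow _ _ _); lia.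
Qed.

Lemma cross_ge l (m : nat) (k := l + m%:Z) :
  zpow a ai k * zpow b bi l * s =
  s * (zpow a ai l * zpow b bi k) + z * ladder a ai b bi k l.
Proof.
rewrite {}/k; elim: m => [|m IH].
  by rewrite addr0 /ladder subrr big_nil mulr0 addr0 -comm_diag.
have bl : b * zpow a ai l = zpow a ai l * b := zpow_two_comm 1 l.
rewrite -addn1 PoszD addrA ladderSl (zpowS aK) -!(mulrA a) IH mulrDr.
rewrite !mulrA cross_a -za !mulrDl mulrDr (zpowS bK) !mulrA.
by rewrite -!(mulrA _ (zpow a ai l) b) -bl !mulrA addrA.
Qed.

Lemma cross_le l (m : nat) (k := l + m%:Z) :
  zpow a ai l * zpow b bi k * s =
  s * (zpow a ai k * zpow b bi l) - z * ladder a ai b bi k l.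
Proof.
rewrite {}/k; elim: m => [|m IH].
  by rewrite addr0 /ladder subrr big_nil mulr0 subr0 -comm_diag.
have bl j : zpow a ai j * b = b * zpow a ai j := esym (zpow_two_comm 1 j).
rewrite -addn1 PoszD addrA ladderSr !(zpowS bK) (zpowS aK) mulrA bl.
rewrite -!(mulrA b) IH mulrBr !mulrA cross_b -zb !mulrBl mulrDr opprD !mulrA.
by rewrite -(mulrA z _ b) bl !mulrA addrA.
Qed.

Lemma bernstein k l :
  zpow a ai k * zpow b bi l * s =
  s * (zpow a ai l * zpow b bi k) + z * dd a ai b bi k l.
Proof.
rewrite /dd; case: leP => kl.
  have [m ->] : exists m : nat, k = l + m%:Z by exists `|k - l|%N; lia.
  exact: cross_ge.
have [m ->] : exists m : nat, l = k + m%:Z by exists `|l - k|%N; lia.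
by rewrite mulrN; exact: cross_le.
Qed.

End TwoStrands.
End Commutation.

(** * Rings satisfying the relations of the affine Hecke algebra *)

Lemma split_pair (T : Type) (D : seq T) j : (0 < j < size D)%N ->
  exists D1 k l D2, D = D1 ++ [:: k, l & D2] /\ (size D1).+1 = j.
Proof.
elim: j D => [|j IH] [|k D] //=; case: j IH => [|j] IH lj.
  by case: D lj => // l D2 _; exists [::], k, l, D2.
have [D1 [k' [l [D2 [-> <-]]]]] := IH D lj.
by exists (k :: D1), k', l, D2.
Qed.

Definition evw (A : pzRingType) (ev : BG -> A) (w : seq BG) : A :=
  \prod_(x <- w) ev x.

(** The condition for [ev] to factor through AH_n on valid words; letters outside AH_n are
    unconstrained. *)
Definition satisfies (A : pzRingType) (n : nat) (ev : BG -> A) : Prop :=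
  forall r, RelB n r -> \sum_(p <- r) evw ev p.2 *~ p.1 = 0.

Section AffineHecke.
Variables (A : pzRingType) (n : nat) (ev : BG -> A).
Hypothesis evR : satisfies n ev.

Local Notation t i := (ev (Sg i)).
Local Notation s i := (ev (Sgi i)).
Local Notation om := (ev Om).
Local Notation omi := (ev Omi).
Local Notation q := (ev Qb).
Local Notation qi := (ev Qbi).
Local Notation z := (q - qi).
Local Notation evw := (evw ev).

Lemma evw_nil : evw [::] = 1. Proof. exact: big_nil. Qed.
Lemma evw_cons x w : evw (x :: w) = ev x * evw w. Proof. exact: big_cons. Qed.
Lemma evw_cat u w : evw (u ++ w) = evw u * evw w. Proof. exact: big_cat. Qed.

Lemma evw_diff u v : RelB n (fdiff u v) -> evw u = evw v.
Proof.
move/evR; rewrite !big_cons big_nil addr0 /= mulr1z mulrNz mulr1z.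
by move/eqP; rewrite subr_eq0 => /eqP.
Qed.

Lemma q_central x : validl n x -> GRing.comm q (ev x).
Proof.
move=> vx; have /evw_diff: RelB n (fdiff [:: Qb; x] [:: x; Qb]) by left; exists x.
by rewrite !evw_cons !evw_nil !mulr1.
Qed.

Lemma qi_central x : validl n x -> GRing.comm qi (ev x).
Proof.
move=> vx; have /evw_diff: RelB n (fdiff [:: Qbi; x] [:: x; Qbi]).
  by right; left; exists x.
by rewrite !evw_cons !evw_nil !mulr1.
Qed.

Lemma qK : q * qi = 1.
Proof.
have /evw_diff: RelB n (fdiff [:: Qb; Qbi] [::]) by do 2!right; left.
by rewrite !evw_cons !evw_nil !mulr1.
Qed.

Lemma Kq : qi * q = 1.
Proof.
have /evw_diff: RelB n (fdiff [:: Qbi; Qb] [::]) by do 3!right; left.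
by rewrite !evw_cons !evw_nil !mulr1.
Qed.

Lemma q_qi_comm : GRing.comm q qi.
Proof. by rewrite /GRing.comm qK Kq. Qed.

Lemma qXK e : q ^+ e * qi ^+ e = 1.
Proof. by rewrite -(exprMn_comm _ q_qi_comm) qK expr1n. Qed.

Lemma omK : (0 < n)%N -> om * omi = 1.
Proof.
move=> n0; have /evw_diff: RelB n (fdiff [:: Om; Omi] [::]).
  by do 4!right; left; split=> //; left.
by rewrite !evw_cons !evw_nil !mulr1.
Qed.

Lemma Kom : (0 < n)%N -> omi * om = 1.
Proof.
move=> n0; have /evw_diff: RelB n (fdiff [:: Omi; Om] [::]).
  by do 4!right; left; split=> //; right.
by rewrite !evw_cons !evw_nil !mulr1.
Qed.

Section Letters.
Variable i : nat.
Hypotheses (n2 : (1 < n)%N) (lt_in : (i < n)%N).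

Lemma tK : t i * s i = 1.
Proof.
have /evw_diff: RelB n (fdiff [:: Sg i; Sgi i] [::]).
  by do 5!right; left; exists i; split=> //; left.
by rewrite !evw_cons !evw_nil !mulr1.
Qed.

Lemma Kt : s i * t i = 1.
Proof.
have /evw_diff: RelB n (fdiff [:: Sgi i; Sg i] [::]).
  by do 5!right; left; exists i; split=> //; right.
by rewrite !evw_cons !evw_nil !mulr1.
Qed.

Lemma om_t : om * t i = t (i.+1 %% n) * om.
Proof.
have /evw_diff: RelB n (fdiff [:: Om; Sg i; Omi] [:: Sg (i.+1 %% n)]).
  by do 8!right; left; exists i; split.
rewrite !evw_cons !evw_nil !mulr1 => <-.
by rewrite -!mulrA Kom ?mulr1 //; lia.
Qed.

Lemma tE : t i = s i + z.
Proof.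
have /evR: RelB n (hecke i) by do 9!right; exists i; split.
rewrite !big_cons big_nil addr0 /= !mulrNz !mulr1z !evw_cons !evw_nil !mulr1.
have cq : GRing.comm q (s i) by apply: q_central; rewrite /= n2.
rewrite qK => /(congr1 ( *%R (s i))); rewrite !mulrDr !mulrN !mulrA mulr0 -cq mulr1.
rewrite -(mulrA q) Kt mulr1 !mul1r addrA => /eqP.
rewrite -opprD subr_eq0 => /eqP tq.
by rewrite addrA (addrC (s i)) -tq addrK.
Qed.

End Letters.

Lemma z_comm x : validl n x -> GRing.comm z (ev x).
Proof.
move=> vx; apply: commr_sym; apply: commrB; apply: commr_sym.
  exact: q_central.
exact: qi_central.
Qed.

Lemma braid i : (0 < i)%N -> (i.+1 < n)%N ->
  t i * t i.+1 * t i = t i.+1 * t i * t i.+1.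
Proof.
move=> i0 lt_in.
have /evw_diff: RelB n (fdiff [:: Sg i; Sg (i.+1 %% n); Sg i]
                  [:: Sg (i.+1 %% n); Sg i; Sg (i.+1 %% n)]).
  by do 6!right; left; exists i; split => //; lia.
by rewrite modn_small // !evw_cons !evw_nil !mulr1 !mulrA.
Qed.

Definition apart i j := (i.+1 < j)%N || (j.+1 < i)%N.

Lemma tC i j : (0 < i < n)%N -> (0 < j < n)%N -> apart i j -> GRing.comm (t i) (t j).
Proof.
move=> li lj aij.
have /evw_diff: RelB n (fdiff [:: Sg i; Sg j] [:: Sg j; Sg i]).
  do 7!right; left; exists i, j; split => //; try lia.
  rewrite /far; case/orP: aij => ij.
    rewrite modn_small; lia.
  rewrite (_ : (i + n - j = i - j + n)%N) ?modnDr ?modn_small; lia.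
by rewrite !evw_cons !evw_nil !mulr1.
Qed.

Lemma om_tS i : (0 < i)%N -> (i.+1 < n)%N -> om * t i = t i.+1 * om.
Proof. by move=> i0 lt_in; rewrite om_t ?modn_small //; lia. Qed.

(** The index wraps around through T_0: omega takes T_(n-1) to T_0, and then T_0 to T_1. *)
Lemma om_om_t : (1 < n)%N -> om * om * t n.-1 = t 1 * om * om.
Proof.
move=> n1; rewrite -mulrA om_t //; last by lia.
rewrite (_ : n.-1.+1 = n) ?modnn; last by lia.
rewrite mulrA om_t ?modn_small //; lia.
Qed.

Definition tw (J : seq nat) : A := \prod_(j <- J) t j.

Lemma tw_cat J K : tw (J ++ K) = tw J * tw K. Proof. exact: big_cat. Qed.
Lemma tw_cons j J : tw (j :: J) = t j * tw J. Proof. exact: big_cons. Qed.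
Lemma tw1 j : tw [:: j] = t j. Proof. exact: big_seq1. Qed.
Lemma tw_nil : tw [::] = 1. Proof. exact: big_nil. Qed.
Lemma evw_tw J : evw [seq Sg j | j <- J] = tw J. Proof. exact: big_map. Qed.

Lemma t_tw_comm i J : (0 < i < n)%N ->
  all (fun j => (0 < j < n)%N && apart i j) J -> GRing.comm (t i) (tw J).
Proof. by move=> li; apply: comm_bigprod => j /andP[lj aij]; apply: tC. Qed.

Definition sw (J : seq nat) : A := \prod_(j <- J) s j.

Lemma sw_cat J K : sw (J ++ K) = sw J * sw K. Proof. exact: big_cat. Qed.
Lemma sw_nil : sw [::] = 1. Proof. exact: big_nil. Qed.
Lemma sw_cons j J : sw (j :: J) = s j * sw J. Proof. exact: big_cons. Qed.
Lemma evw_sw J : evw [seq Sgi j | j <- J] = sw J. Proof. exact: big_map. Qed.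

Lemma tw_swK J : all (fun j => 0 < j < n)%N J -> tw (rev J) * sw J = 1.
Proof.
elim: J => [|j J IH] /=; first by rewrite tw_nil /sw big_nil mulr1.
case/andP=> lj /IH E; rewrite rev_cons -cats1 tw_cat tw1 /sw big_cons.
by rewrite mulrA -(mulrA _ (t j)) tK ?mulr1 //; lia.
Qed.

Lemma sw_twK J : all (fun j => 0 < j < n)%N J -> sw J * tw (rev J) = 1.
Proof.
elim/last_ind: J => [|J j IH] /=; first by rewrite tw_nil /sw big_nil mulr1.
rewrite all_rcons => /andP[lj /IH E]; rewrite rev_rcons tw_cons -cats1 sw_cat.
by rewrite /sw big_seq1 mulrA -(mulrA _ (s j)) Kt ?mulr1 //; lia.
Qed.

Lemma iota_split o m j : (o < j <= o + m)%N ->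
  iota o.+1 m = iota o.+1 (j - o.+1) ++ j :: iota j.+1 (o + m - j).
Proof.
move=> lj; rewrite (_ : m = (j - o.+1 + (o + m - j).+1)%N); last by lia.
by rewrite iotaD (_ : (o.+1 + (j - o.+1))%N = j) //=;
  [congr (_ ++ _ :: iota _ _); lia | lia].
Qed.

Lemma iota_split2 o m j : (o < j < o + m)%N ->
  iota o.+1 m =
  iota o.+1 (j - o.+1) ++ [:: j, j.+1 & iota j.+2 (o + m - j.+1)].
Proof.
move=> lj; rewrite (iota_split (j := j)); last by lia.
rewrite (iota_split (o := j) (j := j.+1)); last by lia.
by rewrite subnn /=; congr (_ ++ [:: _, _ & iota _ _]); lia.
Qed.

(** T_(j+1) passes the letters below j, the braid relation turns T_(j+1) T_j T_(j+1) into T_j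
    T_(j+1) T_j, and the last T_j passes the letters above j + 1. *)
Lemma t_cox o m j : (o + m < n)%N -> (o < j < o + m)%N ->
  t j.+1 * tw (iota o.+1 m) = tw (iota o.+1 m) * t j.
Proof.
move=> lmn lj; rewrite (iota_split2 lj) tw_cat !tw_cons.
set L := tw _; set R := tw _.
have cL : GRing.comm (t j.+1) L.
  apply: t_tw_comm; first by lia.
  by apply/allP=> i; rewrite mem_iota /apart; lia.
have cR : GRing.comm (t j) R.
  apply: t_tw_comm; first by lia.
  by apply/allP=> i; rewrite mem_iota /apart; lia.
rewrite mulrA cL -!mulrA -cR; congr (_ * _); rewrite !mulrA braid //; lia.
Qed.

Lemma s_cox o m j : (o + m < n)%N -> (o < j < o + m)%N ->
  s j.+1 * tw (iota o.+1 m) = tw (iota o.+1 m) * s j.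
Proof.
move=> lmn lj.
rewrite -[LHS]mulr1 -[1](@tK j); [|lia..].
rewrite mulrA -(mulrA (s _)) -t_cox // !mulrA Kt ?mul1r //; lia.
Qed.

Lemma cox_rev m j : (m < n)%N -> (0 < j < m)%N ->
  tw (rev (iota 1 m)) * t j.+1 = t j * tw (rev (iota 1 m)).
Proof.
move=> lmn lj; rewrite (@iota_split2 0 m j) //.
rewrite !rev_cat !rev_cons -!cats1 !tw_cat !tw1.
set L := tw (rev (iota 1 _)); set R := tw _.
have cL : GRing.comm (t j.+1) L.
  apply: t_tw_comm; first by lia.
  by rewrite all_rev; apply/allP=> i; rewrite mem_iota /apart; lia.
have cR : GRing.comm (t j) R.
  apply: t_tw_comm; first by lia.
  by rewrite all_rev; apply/allP=> i; rewrite mem_iota /apart; lia.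
rewrite -!mulrA -cL !mulrA cR -!mulrA; congr (_ * _); rewrite !mulrA.
by rewrite -braid //; lia.
Qed.

(** * The commuting elements y_i *)

Definition yelt i := evw (ywd n i).
Definition yinv i := evw (ywdinv n i).
Local Notation y := yelt.
Local Notation yi := yinv.

Lemma yE i : y i = sw (rev (iota 1 (i - 1))) * (om * tw (rev (iota i (n - i)))).
Proof. by rewrite /yelt /ywd evw_cat (evw_cons Om) evw_tw evw_sw. Qed.

Lemma yiE i : yi i = sw (iota i (n - i)) * (omi * tw (iota 1 (i - 1))).
Proof. by rewrite /yinv /ywdinv evw_cat (evw_cons Omi) evw_tw evw_sw. Qed.

Lemma rev_iotaS o m : rev (iota o m.+1) = (o + m)%N :: rev (iota o m).
Proof. by rewrite -addn1 iotaD rev_cat. Qed.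

Lemma iotaSr o m : iota o m.+1 = iota o m ++ [:: (o + m)%N].
Proof. by rewrite -addn1 iotaD. Qed.

(** In the defining word, raising i adds s_i at the front and drops T_i at the end; the right factor
    s_i does the dropping. *)
Lemma yS i : (0 < i < n)%N -> y i.+1 = s i * y i * s i.
Proof.
case: i => // i lin; rewrite !yE.
rewrite (_ : (n - i.+1 = (n - i.+2).+1)%N); last by lia.
rewrite !subSS !subn0 rev_iotaS add1n /= rev_cons -cats1 tw_cat tw1.
rewrite /sw big_cons -!mulrA tK ?mulr1 //; lia.
Qed.

Lemma yiS i : (0 < i < n)%N -> yi i.+1 = t i * yi i * t i.
Proof.
case: i => // i lin; rewrite !yiE.
rewrite (_ : (n - i.+1 = (n - i.+2).+1)%N); last by lia.
rewrite !subn1 !succnK iotaSr tw_cat tw1 add1n.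
rewrite /sw big_cons -/(sw _) !mulrA tK ?mul1r //; lia.
Qed.

Lemma yK i : (0 < i <= n)%N -> y i * yi i = 1.
Proof.
case: i => // i; elim: i => [|i IH] lin.
  rewrite yE yiE /= tw_nil sw_nil mul1r mulr1 mulrA -(mulrA om) tw_swK ?mulr1 ?omK //.
  by apply/allP=> j; rewrite mem_iota; lia.
rewrite yS // yiS // !mulrA -(mulrA _ (s _)) Kt ?mulr1; [|lia..].
by rewrite -(mulrA _ _ (yi _)) IH ?mulr1 ?Kt //; lia.
Qed.

Lemma Ky i : (0 < i <= n)%N -> yi i * y i = 1.
Proof.
case: i => // i; elim: i => [|i IH] lin.
  rewrite yE yiE /= tw_nil sw_nil mul1r mulr1 mulrA -(mulrA _ omi) Kom ?mulr1 ?sw_twK //.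
  by apply/allP=> j; rewrite mem_iota; lia.
rewrite yS // yiS // !mulrA -(mulrA _ (t _)) tK ?mulr1; [|lia..].
by rewrite -(mulrA _ _ (y _)) IH ?mulr1 ?tK //; lia.
Qed.

Lemma y1E : y 1 = om * tw (rev (iota 1 n.-1)).
Proof. by rewrite yE sw_nil mul1r subn1. Qed.

Lemma comm_s_of_t x i : (0 < i < n)%N -> GRing.comm x (t i) -> GRing.comm x (s i).
Proof. by move=> lin; apply: comm_inv; rewrite ?tK ?Kt //; lia. Qed.

Lemma sC i j : (0 < i < n)%N -> (0 < j < n)%N -> apart i j -> GRing.comm (t i) (s j).
Proof. by move=> li lj aij; apply: comm_s_of_t => //; apply: tC. Qed.

Lemma braid_s i : (0 < i)%N -> (i.+1 < n)%N ->
  t i * s i.+1 * s i = s i.+1 * s i * t i.+1.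
Proof.
move=> i0 lin.
rewrite -[LHS]mul1r -(@Kt i.+1); [|lia..].
have E : t i.+1 * t i * s i.+1 * s i = s i * t i.+1.
  rewrite -[LHS]mul1r -(@Kt i); [|lia..]; rewrite -!mulrA; congr (_ * _).
  rewrite !mulrA braid // -(mulrA _ _ (s i.+1)) tK ?mulr1; [|lia..].
  by rewrite -mulrA tK ?mulr1 //; lia.
by rewrite -!mulrA; congr (_ * _); rewrite !mulrA.
Qed.

Lemma braid_s' i : (0 < i)%N -> (i.+1 < n)%N ->
  t i.+1 * s i * s i.+1 = s i * s i.+1 * t i.
Proof.
move=> i0 lin.
rewrite -[LHS]mul1r -(@Kt i); [|lia..].
have E : t i * t i.+1 * s i * s i.+1 = s i.+1 * t i.
  rewrite -[LHS]mul1r -(@Kt i.+1); [|lia..]; rewrite -!mulrA; congr (_ * _).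
  rewrite !mulrA -braid // -(mulrA _ _ (s i)) tK ?mulr1; [|lia..].
  by rewrite -mulrA tK ?mulr1 //; lia.
by rewrite -!mulrA; congr (_ * _); rewrite !mulrA.
Qed.

Lemma t_y_comm i j : (0 < i <= n)%N -> (0 < j < n)%N -> j != i -> j.+1 != i ->
  GRing.comm (t j) (y i).
Proof.
case: i => // i; elim: i {-2}i (leqnn i) j => [|m IH] [|i] // lim j lin ljn ji jSi.
- rewrite y1E /GRing.comm; case: j ljn ji jSi => // -[//|j] ljn _ _.
  by rewrite -!mulrA cox_rev ?mulrA ?om_tS //; lia.
- rewrite y1E /GRing.comm; case: j ljn ji jSi => // -[//|j] ljn _ _.
  by rewrite -!mulrA cox_rev ?mulrA ?om_tS //; lia.
rewrite yS //; case: (ltnP j i) => [lji|lij].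
  apply: commrM; [apply: commrM|]; [|apply: IH|]; try lia;
    by apply: sC => //; rewrite /apart; lia.
case: (ltnP i.+2 j) => [lji|]; last rewrite leq_eqVlt ltnS => /orP[/eqP|] lji; try lia.
  apply: commrM; [apply: commrM|]; [|apply: IH|]; try lia;
    by apply: sC => //; rewrite /apart; lia.
(* The remaining case is y_(j+2) = s_(j+1) s_j y_j s_j s_(j+1): T_j crosses the first pair as
   T_(j+1), passes y_j by induction, and turns back into T_j on crossing the second pair. *)
have {ji jSi lij lji}ji : j = i by lia.
subst j.
case: i lim lin ljn => [|i] lim lin ljn; first by lia.
rewrite yS; last by lia.
have cy : GRing.comm (t i.+2) (y i.+1) by apply: IH; lia.
rewrite /GRing.comm !mulrA braid_s; [|lia..].
rewrite -!mulrA (mulrA (t i.+2)) cy -!mulrA !(mulrA (t i.+2)) braid_s'; [|lia..].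
by rewrite !mulrA.
Qed.

Lemma om_tw_shift m : (m.+1 < n)%N ->
  tw (rev (iota 2 m)) * om = om * tw (rev (iota 1 m)).
Proof.
elim: m => [|m IH] lmn; first by rewrite !tw_nil mul1r mulr1.
rewrite !rev_iotaS !tw_cons mulrA om_tS; [|lia..].
by rewrite -!mulrA IH //; lia.
Qed.

Lemma cox_rev_tw m k : (m < n)%N -> (k < m)%N ->
  tw (rev (iota 1 m)) * tw (rev (iota 2 k)) =
  tw (rev (iota 1 k)) * tw (rev (iota 1 m)).
Proof.
move=> lmn; elim: k => [|k IH] lkm; first by rewrite !tw_nil mul1r mulr1.
rewrite !(rev_iotaS _ k) add1n add2n (tw_cons k.+2) (tw_cons k.+1) mulrA cox_rev //.
by rewrite -!mulrA IH //; lia.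
Qed.

(** With X = T_(n-1)...T_2 one has y_1 = omega X T_1 and y_2 = s_1 omega X, so the claim amounts to
    T_1 commuting with (omega X)^2 = omega^2 X' X. Moving T_1 through omega^2 gives T_(n-1), and
    T_(n-1) X' = X T_1 is the reversed Coxeter element, which carries X to X'. *)
Lemma y1_y2_comm : (1 < n)%N -> GRing.comm (y 1) (y 2).
Proof.
move=> n1; pose X := tw (rev (iota 2 n.-2)); pose X' := tw (rev (iota 1 n.-2)).
have n1E : n.-1 = n.-2.+1 by lia.
have DX : tw (rev (iota 1 n.-1)) = X * t 1.
  by rewrite n1E /= rev_cons -cats1 tw_cat tw1.
have DX' : tw (rev (iota 1 n.-1)) = t n.-1 * X'.
  by rewrite n1E rev_iotaS tw_cons.
have Xom : X * om = om * X' by apply: om_tw_shift; lia.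
have y2E : y 2 = s 1 * (om * X).
  by rewrite yE [rev (iota 1 _)]/= sw_cons sw_nil mulr1 subn2.
have key : t 1 * (om * X * (om * X)) = om * X * (om * X) * t 1.
  have -> : om * X * (om * X) = om * om * (X' * X).
    by rewrite mulrA -(mulrA om X) Xom !mulrA.
  rewrite mulrA (mulrA (t 1)) -om_om_t // -!mulrA; do 2!congr (_ * _).
  by rewrite -DX mulrA -DX' cox_rev_tw //; lia.
have t1K : t 1 * s 1 = 1 by apply: tK.
rewrite /GRing.comm y1E DX y2E !mulrA -(mulrA _ (t 1)) t1K mulr1.
move: key => /(congr1 ( *%R (s 1))); rewrite mulrA Kt ?mul1r ?mulrA //; lia.
Qed.

(** Starting from the pair (1, 2), the formula y_(i+1) = s_i y_i s_i raises first the larger index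
    and then the smaller one; each time s_i commutes with the other element. *)
Lemma y_comm i j : (0 < i <= n)%N -> (0 < j <= n)%N -> GRing.comm (y i) (y j).
Proof.
have H : forall i d, (0 < i)%N -> (i + d.+1 <= n)%N ->
    GRing.comm (y i) (y (i + d.+1)%N).
  case=> // k d _; elim: k d => [|k IHk] d.
    elim: d => [|d IHd] lkn; first by apply: y1_y2_comm; lia.
    rewrite (_ : 1 + d.+2 = (1 + d.+1).+1)%N // (yS (i := (1 + d.+1)%N)); last by lia.
    have cs : GRing.comm (y 1) (s (1 + d.+1)).
      apply: comm_s_of_t; first by lia.
      by apply: commr_sym; apply: t_y_comm; lia.
    by apply: commrM => //; apply: commrM => //; apply: IHd; lia.
  move=> lkn; rewrite (yS (i := k.+1)); last by lia.
  have cs : GRing.comm (y (k.+2 + d.+1)) (s k.+1).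
    apply: comm_s_of_t; first by lia.
    by apply: commr_sym; apply: t_y_comm; lia.
  apply: commr_sym; apply: commrM => //; apply: commrM => //; apply: commr_sym.
  by rewrite (_ : k.+2 + d.+1 = k.+1 + d.+2)%N; [apply: IHk; lia | lia].
move=> li lj; case: (ltngtP i j) => [lij|lji|->//].
  by rewrite (_ : j = i + (j - i).-1.+1)%N; [apply: H; lia | lia].
apply: commr_sym.
by rewrite (_ : i = j + (i - j).-1.+1)%N; [apply: H; lia | lia].
Qed.

Definition yp i k := zpow (y i) (yi i) k.

Lemma comm_yp x i k : (0 < i <= n)%N -> GRing.comm x (y i) -> GRing.comm x (yp i k).
Proof.
move=> li cx; apply: comm_zpow => //.
by apply: comm_inv cx; [exact: yK | exact: Ky].
Qed.

Lemma yp_comm i j k l : (0 < i <= n)%N -> (0 < j <= n)%N ->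
  GRing.comm (yp i k) (yp j l).
Proof.
move=> li lj; apply: comm_yp => //; apply: commr_sym; apply: comm_yp => //.
exact: y_comm.
Qed.

Lemma ypS i k : (0 < i <= n)%N -> yp i (k + 1) = y i * yp i k.
Proof. by move=> li; apply: zpowS; apply: yK. Qed.

Lemma ypP i k : (0 < i <= n)%N -> yp i (k - 1) = yi i * yp i k.
Proof. by move=> li; apply: zpowP; [apply: yK | apply: Ky]. Qed.

Lemma t_yp_comm i j k : (0 < i <= n)%N -> (0 < j < n)%N -> j != i -> j.+1 != i ->
  GRing.comm (t j) (yp i k).
Proof. by move=> *; apply: comm_yp => //; apply: t_y_comm. Qed.

(** Commutation with all of [A] would be too strong: [A] may contain images of letters outside AH_n,
    with which q need not commute. *)
Definition central x := forall w, valid n w -> GRing.comm x (evw w).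

Lemma central_of_letters x :
  (forall l, validl n l -> GRing.comm x (ev l)) -> central x.
Proof. by move=> cx w; apply: comm_bigprod. Qed.

Lemma valid_ywd i : (0 < i <= n)%N -> valid n (ywd n i).
Proof.
move=> li; rewrite /valid /ywd all_cat /= !all_map.
apply/and3P; split; [|by lia|]; apply/allP=> j; rewrite mem_rev mem_iota /=; lia.
Qed.

Lemma valid_ywdinv i : (0 < i <= n)%N -> valid n (ywdinv n i).
Proof.
move=> li; rewrite /valid /ywdinv all_cat /= !all_map.
apply/and3P; split; [|by lia|]; apply/allP=> j; rewrite mem_iota /=; lia.
Qed.

Lemma valid_ypow i k : (0 < i <= n)%N -> valid n (ypow n i k).
Proof.
have vf w m : valid n w -> valid n (flatten (nseq m w)).
  by move=> vw; elim: m => //= m IH; rewrite /valid all_cat; apply/andP.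
move=> li; rewrite /ypow; case: ifP => _; apply: vf.
  exact: valid_ywd.
exact: valid_ywdinv.
Qed.

Lemma evw_ypow i k : evw (ypow n i k) = yp i k.
Proof.
have ef w m : evw (flatten (nseq m w)) = evw w ^+ m.
  elim: m => [|m IH] /=; first by rewrite evw_nil.
  by rewrite evw_cat IH exprS.
by rewrite /ypow /yp /zpow; case: ifP => _; rewrite ef.
Qed.

Lemma central_yp x i k : central x -> (0 < i <= n)%N -> GRing.comm x (yp i k).
Proof. by move=> cx li; rewrite -evw_ypow; apply: cx; apply: valid_ypow. Qed.

(** The offset [o] places the monomial on the strands o + 1, o + 2, ..., which is how blocks are
    juxtaposed. *)
Fixpoint Ys (o : nat) (D : seq int) : A :=
  if D is d :: D' then yp o.+1 d * Ys o.+1 D' else 1.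

Lemma Ys_cat o D D' : Ys o (D ++ D') = Ys o D * Ys (o + size D) D'.
Proof.
elim: D o => [|d D IH] o /=; first by rewrite mul1r addn0.
by rewrite IH mulrA addSnnS.
Qed.

Lemma comm_Ys x o D :
  (forall i k, (o < i <= o + size D)%N -> GRing.comm x (yp i k)) ->
  GRing.comm x (Ys o D).
Proof.
elim: D o => [|d D IH] o cx /=; first exact: commr1.
apply: commrM; first by apply: cx => /=; lia.
by apply: IH => i k li; apply: cx => /=; lia.
Qed.

Lemma t_Ys_comm j o D : (0 < j < n)%N -> (o + size D <= n)%N ->
  (j < o)%N || (o + size D < j)%N -> GRing.comm (t j) (Ys o D).
Proof. by move=> lj lD jD; apply: comm_Ys => i k li; apply: t_yp_comm; lia. Qed.

Lemma yp_Ys_comm i k o D : (0 < i <= n)%N -> (o + size D <= n)%N ->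
  GRing.comm (yp i k) (Ys o D).
Proof. by move=> li lD; apply: comm_Ys => j l lj; apply: yp_comm; lia. Qed.

Lemma central_Ys x o D : central x -> (o + size D <= n)%N -> GRing.comm x (Ys o D).
Proof. by move=> cx lD; apply: comm_Ys => j l lj; apply: central_yp => //; lia. Qed.

Lemma central_tw x J : central x -> all (fun j => 0 < j < n)%N J ->
  GRing.comm x (tw J).
Proof.
move=> cx vJ; rewrite -evw_tw; apply: cx; rewrite /valid all_map.
by apply: sub_all vJ => j /=; lia.
Qed.

Lemma z_central : central z.
Proof. by apply: central_of_letters => l; exact: z_comm. Qed.

Lemma central_z C : central C -> GRing.comm z C.
Proof.
move=> cC; apply: commr_sym; have := cC [:: Qb] isT; have := cC [:: Qbi] isT.
by rewrite /evw !big_seq1 => *; apply: commrB.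
Qed.

Definition ydd i k l := dd (y i) (yi i) (y i.+1) (yi i.+1) k l.

Lemma bernstein_y i k l : (0 < i < n)%N ->
  yp i k * yp i.+1 l * s i = s i * (yp i l * yp i.+1 k) + z * ydd i k l.
Proof.
move=> li; have zc j : (0 < j <= n)%N -> GRing.comm z (y j).
  by move=> lj; exact: z_central (valid_ywd lj).
apply: (@bernstein A _ _ _ _ (t i) _ z).
- by apply: yK; lia.
- by apply: Ky; lia.
- by apply: yK; lia.
- by apply: Ky; lia.
- by apply: tK; lia.
- by apply: Kt; lia.
- by apply: tE; lia.
- by apply: y_comm; lia.
- exact: yS.
- by apply: zc; lia.
- by apply: zc; lia.
Qed.

Lemma y_tw_comm i J : (0 < i <= n)%N ->
  all (fun j => [&& 0 < j < n, j != i & j.+1 != i])%N J -> GRing.comm (y i) (tw J).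
Proof.
move=> li; apply: comm_bigprod => j /and3P[lj ji jSi]; apply: commr_sym.
exact: t_y_comm.
Qed.

(** * Identities under a trace function *)

Section Trace.
Variables (V : zmodType) (tau : {additive A -> V}).
Hypothesis tauC : forall x y, tau (x * y) = tau (y * x).

(** The lists [JL] and [JR] hold the letters below and above i, so T_i may sit inside a longer block
    with further blocks on both sides. On the right T_i is gone: the block is cut there. *)
Lemma skein_split C D1 k l D2 JL JR (i := (size D1).+1) :
  central C -> (size D1 + (size D2).+2 <= n)%N ->
  all (fun j => 0 < j < i)%N JL -> all (fun j => i < j < n)%N JR ->
  tau (C * Ys 0 (D1 ++ [:: k, l & D2]) * tw (JL ++ i :: JR)) -
  tau (C * Ys 0 (D1 ++ [:: k - 1, l + 1 & D2]) * tw (JL ++ i :: JR)) =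
  tau (z * C * Ys 0 (D1 ++ [:: k, l & D2]) * tw (JL ++ JR)).
Proof.
move=> cC szn JLi JRi; set Y := Ys 0 (D1 ++ [:: k, l & D2]).
have li : (0 < i < n)%N by rewrite /i; lia.
have vJL : all (fun j => 0 < j < n)%N JL by apply: sub_all JLi => j /=; lia.
have -> : Ys 0 (D1 ++ [:: k - 1, l + 1 & D2]) = yi i * Y * y i.+1.
  have cyi := @yp_Ys_comm i (-1) 0 D1; have cy := @yp_Ys_comm i.+1 1.
  rewrite /Y !Ys_cat /= !add0n ypP ?ypS; [|rewrite /i; lia..].
  rewrite -/i -!mulrA !(mulrA (yi i)) {}cyi; [|rewrite /i; lia..].
  rewrite -!mulrA; do 3!congr (_ * _).
  rewrite mulrA (mulrA (yp i.+1 l)) (@yp_comm _ _ 1 l) -?mulrA; [|rewrite /i; lia..].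
  by congr (_ * _); rewrite (cy i.+1) //; rewrite /i; lia.
have cyL : GRing.comm (y i.+1) (tw JL).
  apply: y_tw_comm; first by rewrite /i; lia.
  by apply: sub_all JLi => j /=; rewrite /i; lia.
have cyR : GRing.comm (y i) (tw JR).
  apply: y_tw_comm; first by rewrite /i; lia.
  by apply: sub_all JRi => j /=; rewrite /i; lia.
have ty : y i.+1 * t i = s i * y i by rewrite yS // -mulrA Kt ?mulr1 //; lia.
(* y_(i+1) crosses [JL] and turns T_i into s_i y_i; this y_i crosses [JR] and, around the trace,
   cancels [yi i]. *)
have -> : tau (C * (yi i * Y * y i.+1) * tw (JL ++ i :: JR)) =
          tau (C * Y * tw JL * s i * tw JR).
  rewrite tw_cat tw_cons -!mulrA (mulrA (y i.+1)) cyL -!mulrA (mulrA (y i.+1)) ty.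
  rewrite -!mulrA cyR !mulrA tauC !mulrA.
  have -> : y i * C = C * y i by rewrite (cC _ (valid_ywd _)) //; lia.
  by rewrite -(mulrA C) yK ?mulr1 //; lia.
rewrite -raddfB !tw_cat tw_cons (tE (i := i)); [|lia..]; rewrite mulrDl mulrDr !mulrA.
rewrite mulrDr !mulrA addrC addKr; congr (tau (_ * _)).
have zY : GRing.comm z (C * Y * tw JL).
  apply: commrM; last exact: central_tw z_central vJL.
  apply: commrM; first exact: central_z.
  by apply: central_Ys z_central _; rewrite size_cat /=; lia.
by rewrite -zY !mulrA.
Qed.

Lemma Ys_ladder D1 D2 k l (i := (size D1).+1) :
  \sum_(a <- iota 1 `|k - l|%N)
    Ys 0 (D1 ++ [:: k - a%:Z; l + a%:Z] ++ D2) =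
  Ys 0 D1 * ladder (y i) (yi i) (y i.+1) (yi i.+1) k l * Ys i.+1 D2.
Proof.
rewrite /ladder big_distrr big_distrl /=; apply: eq_bigr => a _.
by rewrite Ys_cat /= add0n !mulrA.
Qed.

Lemma Ys_cterms D1 d D2 k j (i := (size D1 + j).+1) : (j < size d)%N ->
  \sum_(p <- cterms k d j) Ys 0 (D1 ++ p.2 ++ D2) *~ p.1 =
  Ys 0 (D1 ++ take j d) * ydd i k (nth 0 d j) * Ys i.+1 (drop j.+1 d ++ D2).
Proof.
move=> ljd; rewrite /cterms /ydd /dd.
have szi : size (D1 ++ take j d) = (size D1 + j)%N.
  by rewrite size_cat size_takel // ltnW.
case: leP => _; rewrite big_map.
  rewrite /i -szi -Ys_ladder; apply: eq_bigr => a _ /=.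
  by rewrite -!catA.
rewrite mulrN mulNr /i -szi -Ys_ladder -sumrN; apply: eq_bigr => a _ /=.
by rewrite -!catA mulrNz.
Qed.

Section SkeinCommutator.
Variables (C : A) (D1 d D2 : seq int) (k : int) (JA JB : seq nat).
Local Notation o := (size D1).
Local Notation m := (size d).
Hypotheses (cC : central C) (sz : (o + m.+1 + size D2 <= n)%N).
Hypothesis JAo : all (fun j => 0 < j < o)%N JA.
Hypothesis JBo : all (fun j => o + m.+1 < j < n)%N JB.

Let ins j := D1 ++ (take j d ++ k :: drop j d) ++ D2.
Let cox := tw (iota o.+1 m).

(** Bernstein's relation exchanges k with the entry of [d] at j and releases s_i on the left. This
    s_i moves to the front, around the trace and back past [JB], to end up on the right of the
    Coxeter element. *)
Lemma skein_step j : (j < m)%N ->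
  tau (C * Ys 0 (ins j) * tw JA * s (o + j).+1 * cox * tw JB) =
  tau (C * Ys 0 (ins j.+1) * tw JA * cox * s (o + j).+1 * tw JB) +
  \sum_(p <- cterms k d j)
    tau (z * C * Ys 0 (D1 ++ p.2 ++ D2) * tw JA * cox * tw JB) *~ p.1.
Proof.
move=> ljm; set i := (o + j).+1; have li : (0 < i < n)%N by rewrite /i; lia.
have szi : size (D1 ++ take j d) = (o + j)%N by rewrite size_cat size_takel // ltnW.
set dj := nth 0 d j; pose Y1 := Ys 0 (D1 ++ take j d).
pose Y2 := Ys i.+1 (drop j.+1 d ++ D2).
have szd : size (drop j.+1 d ++ D2) = (m - j.+1 + size D2)%N.
  by rewrite size_cat size_drop.
have YE e f : Ys 0 (D1 ++ (take j d ++ [:: e, f & drop j.+1 d]) ++ D2) =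
    Y1 * (yp i e * yp i.+1 f) * Y2.
  by rewrite -!catA /= catA Ys_cat add0n szi /= -!mulrA.
have -> : ins j = D1 ++ (take j d ++ [:: k, dj & drop j.+1 d]) ++ D2.
  by rewrite /ins (drop_nth 0 ljm).
have -> : ins j.+1 = D1 ++ (take j d ++ [:: dj, k & drop j.+1 d]) ++ D2.
  by rewrite /ins (take_nth 0 ljm) -cats1 -!catA.
have cs x : GRing.comm x (t i) -> GRing.comm x (s i) by exact: comm_s_of_t.
have csA : GRing.comm (tw JA) (s i).
  apply: cs; apply: commr_sym; apply: t_tw_comm => //.
  by apply: sub_all JAo => h; rewrite /apart /i; lia.
have csB : GRing.comm (tw JB) (s i).
  apply: cs; apply: commr_sym; apply: t_tw_comm => //.
  by apply: sub_all JBo => h; rewrite /apart /i; lia.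
have csY1 : GRing.comm Y1 (s i).
  by apply: cs; apply: commr_sym; apply: t_Ys_comm; rewrite ?szi /i; lia.
have csY2 : GRing.comm Y2 (s i).
  by apply: cs; apply: commr_sym; apply: t_Ys_comm; rewrite ?szd /i; lia.
have csC : GRing.comm C (s i).
  have := cC (w := [:: Sgi i]); rewrite /evw big_seq1; apply.
  by rewrite /= andbT; lia.
have zY1 : GRing.comm z Y1 by apply: central_Ys z_central _; rewrite szi /i; lia.
rewrite !YE -!mulrA (mulrA (tw JA)) csA -!mulrA (mulrA Y2) csY2 -!mulrA.
rewrite (mulrA (yp i.+1 _)) !(mulrA (yp i _)).
rewrite bernstein_y // mulrDl !mulrDr raddfD /=; congr (_ + _).
  rewrite -!mulrA (mulrA Y1) csY1 -!mulrA (mulrA C) csC -mulrA tauC -!mulrA csB.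
  by rewrite !mulrA.
transitivity (\sum_(p <- cterms k d j) tau (z * C *
    (Ys 0 (D1 ++ p.2 ++ D2) *~ p.1) * (tw JA * (cox * tw JB)))); last first.
  by apply: eq_bigr => p _; rewrite -raddfMz !mulrA mulrzAr !mulrzAl.
rewrite -raddf_sum -!big_distrl -big_distrr /= Ys_cterms // -/Y1 -/Y2.
by rewrite (central_z cC) -!mulrA (mulrA z Y1) zY1 -!mulrA.
Qed.

Lemma skein_commutator : (0 < m)%N ->
  tau (C * Ys 0 (D1 ++ (k :: d) ++ D2) * tw (JA ++ iota o.+2 m.-1 ++ JB)) -
  tau (C * Ys 0 (D1 ++ rcons d k ++ D2) * tw (JA ++ iota o.+1 m.-1 ++ JB)) =
  \sum_(p <- flatten [seq cterms k d j | j <- iota 0 m])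
    tau (z * C * Ys 0 (D1 ++ p.2 ++ D2) * tw (JA ++ iota o.+1 m ++ JB)) *~ p.1.
Proof.
move=> m0; have mE : m = m.-1.+1 by rewrite prednK.
have ons : (o + m < n)%N by lia.
(* The inverse letter in [skein_step] is chosen so that it cancels the first letter of [cox] at j =
   0 and the last one at j = m - 1. What remains are the two products, with the strand of exponent k
   split off. *)
have F0 : s (o + 0).+1 * cox = tw (iota o.+2 m.-1).
  by rewrite /cox mE /= tw_cons mulrA addn0 Kt ?mul1r //; lia.
have Gm : cox * s (o + m.-1).+1 = tw (iota o.+1 m.-1).
  rewrite /cox mE iotaSr tw_cat tw1 addSn -mulrA succnK tK ?mulr1 //; lia.
pose F j := tau (C * Ys 0 (ins j) * tw JA * s (o + j).+1 * cox * tw JB).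
pose G j := tau (C * Ys 0 (ins j.+1) * tw JA * cox * s (o + j).+1 * tw JB).
have FG j : (j.+1 < m)%N -> F j.+1 = G j.
  move=> ljm; rewrite /F /G; congr (tau (_ * _)); rewrite -!mulrA.
  by do 3!congr (_ * _); rewrite addnS s_cox //; lia.
have telescope h : (h < m)%N ->
    F 0%N - G h = \sum_(0 <= j < h.+1) (F j - G j).
  elim: h => [|h IH] lhm; first by rewrite big_nat1.
  by rewrite big_nat_recr //= -IH ?FG ?subrKA //; lia.
transitivity (F 0%N - G m.-1).
  congr (_ - _).
    rewrite /F -(mulrA (_ * tw JA)) F0 !tw_cat !mulrA; congr (tau (_ * _ * _ * _ * _)).
    by rewrite /ins take0 drop0.
  rewrite /G -(mulrA (_ * tw JA) cox) Gm !tw_cat !mulrA -mE.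
  by rewrite /ins take_size drop_size cats1.
rewrite telescope; last by lia.
rewrite -mE big_flatten big_map /index_iota subn0 big_seq [RHS]big_seq.
apply: eq_bigr => j; rewrite mem_iota add0n => /andP[_ ljm].
rewrite /F /G skein_step // addrC addKr; apply: eq_bigr => p _.
by rewrite !tw_cat !mulrA.
Qed.

End SkeinCommutator.
End Trace.

(* [fin m] is the finite Hecke algebra on [m] strands, so it stops at [t m.-1]. *)
Inductive fin (m : nat) : A -> Prop :=
| fin0 : fin m 0
| fin1 : fin m 1
| finD x x' : fin m x -> fin m x' -> fin m (x + x')
| finN x : fin m x -> fin m (- x)
| finq x : fin m x -> fin m (q * x)
| finqi x : fin m x -> fin m (qi * x)
| fint j x : (0 < j < m)%N -> fin m x -> fin m (t j * x).

Lemma finM m x x' : fin m x -> fin m x' -> fin m (x * x').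
Proof.
move=> fx fx'; elim: fx => [||u v _ IHu _ IHv|u _ IH|u _ IH|u _ IH|j u lj _ IH].
- by rewrite mul0r; apply: fin0.
- by rewrite mul1r.
- by rewrite mulrDl; apply: finD.
- by rewrite mulNr; apply: finN.
- by rewrite -mulrA; apply: finq.
- by rewrite -mulrA; apply: finqi.
- by rewrite -mulrA; apply: fint.
Qed.

Lemma fin_t m j : (0 < j < m)%N -> fin m (t j).
Proof. by move=> lj; rewrite -[t j]mulr1; apply: fint => //; apply: fin1. Qed.

Lemma finz m x : fin m x -> fin m (z * x).
Proof. by move=> fx; rewrite mulrBl; apply: finD; [exact: finq|apply/finN/finqi]. Qed.

Lemma fin_s m j : (m <= n)%N -> (0 < j < m)%N -> fin m (s j).
Proof.
move=> lmn lj; rewrite -[s j](addrK z) -tE; [|lia..].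
apply: finD; first exact: fin_t.
by apply: finN; rewrite -[z]mulr1; apply: finz; apply: fin1.
Qed.

Lemma fin_comm m c x : GRing.comm c q -> GRing.comm c qi ->
  (forall j, (0 < j < m)%N -> GRing.comm c (t j)) -> fin m x -> GRing.comm c x.
Proof.
move=> cq cqi ct; elim=> [||u v _ IHu _ IHv|u _ IH|u _ IH|u _ IH|j u lj _ IH].
- exact: commr0.
- exact: commr1.
- exact: commrD.
- exact: commrN.
- exact: commrM.
- exact: commrM.
- by apply: commrM => //; apply: ct.
Qed.

Lemma central_q : central q.
Proof. exact: central_of_letters q_central. Qed.

Lemma central_qi : central qi.
Proof. exact: central_of_letters qi_central. Qed.

Lemma tw_fin_comm m J x : all (fun j => 0 < j < n)%N J ->
  all (fun j => m < j)%N J -> (m <= n)%N -> fin m x -> GRing.comm (tw J) x.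
Proof.
move=> vJ mJ lmn; apply: fin_comm => [||j lj]; apply: commr_sym.
- exact: central_tw central_q vJ.
- exact: central_tw central_qi vJ.
apply: t_tw_comm; first by lia.
by apply/allP=> i iJ; move: (allP vJ i iJ) (allP mJ i iJ); rewrite /apart; lia.
Qed.

Lemma t_fin_comm m j x : (m < j < n)%N -> fin m x -> GRing.comm (t j) x.
Proof. by move=> lj; rewrite -tw1; apply: tw_fin_comm; rewrite /= ?andbT; lia. Qed.

(** * Double cosets in the finite Hecke algebra and spanning monomials *)

Inductive bruhat (m : nat) : A -> Prop :=
| bruhat_fin x : fin m x -> bruhat m x
| bruhat_t a b : (0 < m)%N -> fin m a -> fin m b -> bruhat m (a * t m * b)
| bruhatD x x' : bruhat m x -> bruhat m x' -> bruhat m (x + x').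

Lemma bruhat_mul m c x : fin m c -> bruhat m x -> bruhat m (c * x).
Proof.
move=> fc; elim=> [u fu|a b m0 fa fb|u v _ IHu _ IHv].
- by apply: bruhat_fin; apply: finM.
- by rewrite !mulrA; apply: bruhat_t => //; apply: finM.
- by rewrite mulrDr; apply: bruhatD.
Qed.

Lemma t_sqr j : (0 < j < n)%N -> t j * t j = 1 + t j * z.
Proof. by move=> lj; rewrite {2}tE ?mulrDr ?tK //; lia. Qed.

(** Only T_(m+1) a T_(m+1) b needs work in the inductive step, and there a is decomposed one level
    down. If a lies in H_m it commutes with T_(m+1), which leaves a square; if it has the form a T_m
    a', the outer factors move out and the braid relation leaves a single T_(m+1). *)
Lemma fin_bruhat m x : (m < n)%N -> fin m.+1 x -> bruhat m x.
Proof.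
elim: m x => [|m IH] x lmn.
  move=> fx; apply: bruhat_fin.
  elim: fx => [||u v _ IHu _ IHv|u _ IHu|u _ IHu|u _ IHu|j u lj _ IHu]; last by lia.
  - exact: fin0.
  - exact: fin1.
  - exact: finD.
  - exact: finN.
  - exact: finq.
  - exact: finqi.
have f1 := fin1 m.+1.
have fS k u : fin k u -> fin k.+1 u.
  elim=> [||? ? _ ? _ ?|? _ ?|? _ ?|? _ ?|j ? lj _ ?].
  - exact: fin0.
  - exact: fin1.
  - exact: finD.
  - exact: finN.
  - exact: finq.
  - exact: finqi.
  - by apply: fint => //; lia.
have scal c u : (forall k v, fin k v -> fin k (c * v)) -> bruhat m.+1 u -> bruhat m.+1 (c * u).
  by move=> fc; apply: bruhat_mul; rewrite -[c]mulr1; apply: fc; apply: fin1.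
elim=> [||u v _ IHu _ IHv|u _ IHu|u _ IHu|u _ IHu|j u lj _ IHu].
- by apply: bruhat_fin; apply: fin0.
- exact: bruhat_fin.
- exact: bruhatD.
- by rewrite -mulN1r; apply: bruhat_mul => //; apply: finN.
- by apply: scal => // k v; apply: finq.
- by apply: scal => // k v; apply: finqi.
case: (ltnP j m.+1) => ljm; first by apply: bruhat_mul => //; apply: fin_t; lia.
have {lj ljm}-> : j = m.+1 by lia.
elim: IHu => {u} [u fu|a b _ fa fb|u v _ IHu _ IHv].
- by rewrite -[t _]mul1r; apply: bruhat_t.
- elim: (IH _ (ltnW lmn) fa) => {a fa} [a fa|a a' m0 fa fa'|a a' _ IHa _ IHa'].
  + have ca : GRing.comm (t m.+1) a by apply: t_fin_comm fa; lia.
    rewrite !mulrA ca -(mulrA a) t_sqr // mulrDr mulr1 mulrDl.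
    apply: bruhatD; first by apply: bruhat_fin; apply: finM => //; apply: fS.
    rewrite !mulrA -(mulrA _ z b); apply: bruhat_t; rewrite ?fS //.
      exact: fS.
    by apply: finz.
  + have ca : GRing.comm (t m.+1) a by apply: t_fin_comm fa; lia.
    have ca' : GRing.comm (t m.+1) a' by apply: t_fin_comm fa'; lia.
    rewrite !mulrA ca -(mulrA _ a') -ca' !mulrA -(mulrA a) -(mulrA a) -braid //.
    rewrite (_ : _ * b = a * t m * t m.+1 * (t m * (a' * b))); last by rewrite !mulrA.
    apply: bruhat_t => //.
      by apply: finM; [exact: fS | apply: fin_t; lia].
    by apply: fint; [lia | apply: finM => //; exact: fS].
  + by rewrite !mulrDl mulrDr; apply: bruhatD.
- by rewrite mulrDr; apply: bruhatD.
Qed.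

(** The monomial always runs over all n strands, while [h] ranges over H_m only: [m] is the
    parameter of the descent in [cocenter_pbw]. *)
Inductive pbw (m : nat) : A -> Prop :=
| pbw_in D h : size D = n -> fin m h -> pbw m (Ys 0 D * h)
| pbwD x x' : pbw m x -> pbw m x' -> pbw m (x + x').

Lemma pbw_fin m x h : pbw m x -> fin m h -> pbw m (x * h).
Proof.
move=> px fh; elim: px => [D h' sD fh'|u v _ IHu _ IHv].
  by rewrite -mulrA; apply: pbw_in => //; apply: finM.
by rewrite mulrDl; apply: pbwD.
Qed.

Lemma pbw0 m : pbw m 0.
Proof.
rewrite -(mulr0 (Ys 0 (nseq n 0))); apply: pbw_in; last exact: fin0.
by rewrite size_nseq.
Qed.

Lemma pbw_sum m (I : Type) (r : seq I) (F : I -> A) :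
  (forall i, pbw m (F i)) -> pbw m (\sum_(i <- r) F i).
Proof.
move=> pF; elim: r => [|i r IH]; first by rewrite big_nil; apply: pbw0.
by rewrite big_cons; apply: pbwD.
Qed.

Lemma pbw_central m c x : central c -> (forall h, fin m h -> fin m (c * h)) ->
  pbw m x -> pbw m (c * x).
Proof.
move=> cc fc; elim=> [D h sD fh|u v _ IHu _ IHv].
  rewrite mulrA (central_Ys cc) ?sD // -mulrA; apply: pbw_in => //.
  exact: fc.
by rewrite mulrDr; apply: pbwD.
Qed.

Lemma pbwN m x : pbw m x -> pbw m (- x).
Proof.
move=> px; rewrite -mulN1r; apply: pbw_central px => [w vw|h fh].
  by rewrite /GRing.comm mulN1r mulrN1.
by rewrite mulN1r; apply: finN.
Qed.

Lemma pbwz m x : pbw m x -> pbw m (z * x).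
Proof. by apply: pbw_central z_central _ => h; apply: finz. Qed.

Lemma pbw_ladder m D1 D2 k l (i := (size D1).+1) : (size D1 + (size D2).+2)%N = n ->
  pbw m (Ys 0 D1 * ladder (y i) (yi i) (y i.+1) (yi i.+1) k l * Ys i.+1 D2).
Proof.
move=> sD; rewrite -Ys_ladder; apply: pbw_sum => a; rewrite -[Ys _ _]mulr1.
by apply: pbw_in (fin1 m); rewrite !size_cat.
Qed.

Lemma pbw_s m j x : (m <= n)%N -> (0 < j < m)%N -> pbw m x -> pbw m (s j * x).
Proof.
move=> lmn lj; elim=> [D h sD fh|u v _ IHu _ IHv]; last first.
  by rewrite mulrDr; apply: pbwD.
rewrite mulrA; apply: pbw_fin => // {h fh}.
have [D1 [k [l [D2 [DE s1]]]]] := @split_pair _ D j ltac:(rewrite sD; lia).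
have {DE sD} sD : (size D1 + (size D2).+2)%N = n /\ D = D1 ++ [:: k, l & D2].
  by split=> //; rewrite -sD DE size_cat.
case: sD => sD ->; have jE : (size D1).+1 = j by lia.
have csY1 : GRing.comm (Ys 0 D1) (s j).
  apply: comm_s_of_t; first by lia.
  by apply: commr_sym; apply: t_Ys_comm; lia.
have csY2 : GRing.comm (Ys j.+1 D2) (s j).
  apply: comm_s_of_t; first by lia.
  by apply: commr_sym; apply: t_Ys_comm; lia.
have zY1 : GRing.comm z (Ys 0 D1) by apply: central_Ys z_central _; lia.
(* [bernstein_y] with k and l exchanged, solved for the term with s_j on the left. *)
have E : s j * Ys 0 (D1 ++ [:: k, l & D2]) =
    Ys 0 (D1 ++ [:: l, k & D2]) * s j - z * (Ys 0 D1 * ydd j l k * Ys j.+1 D2).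
  rewrite !Ys_cat /= add0n jE -!mulrA csY2 !mulrA -csY1 zY1.
  rewrite -!(mulrA (Ys 0 D1)) bernstein_y; last by lia.
  by rewrite mulrDl mulrDr addrK !mulrA.
rewrite E; apply: pbwD.
  by apply: pbw_in; [rewrite size_cat | apply: fin_s].
apply: pbwN; apply: pbwz; rewrite /ydd /dd -{}jE.
by case: ifP => _; rewrite ?mulrN ?mulNr; try apply: pbwN; apply: pbw_ladder.
Qed.

Lemma pbw_t m j x : (m <= n)%N -> (0 < j < m)%N -> pbw m x -> pbw m (t j * x).
Proof.
move=> lmn lj px; rewrite tE; [rewrite mulrDl|lia..].
by apply: pbwD; [apply: pbw_s | apply: pbwz].
Qed.

Lemma fin_pbw m h x : (m <= n)%N -> fin m h -> pbw m x -> pbw m (h * x).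
Proof.
move=> lmn fh px; elim: fh => [||u v _ IHu _ IHv|u _ IH|u _ IH|u _ IH|j u lj _ IH].
- by rewrite mul0r; apply: pbw0.
- by rewrite mul1r.
- by rewrite mulrDl; apply: pbwD.
- by rewrite mulNr; apply: pbwN.
- by rewrite -mulrA; apply: pbw_central central_q _ IH => v; apply: finq.
- by rewrite -mulrA; apply: pbw_central central_qi _ IH => v; apply: finqi.
- by rewrite -mulrA; apply: pbw_t.
Qed.

Lemma pbw_y1 m x : (0 < n)%N -> pbw m x -> pbw m (y 1 * x) /\ pbw m (yi 1 * x).
Proof.
move=> n0; elim=> [[|d D] h sD fh|u v _ [IHu IHu'] _ [IHv IHv']].
- by move: sD n0 => /= <-.
- split; rewrite !mulrA /= -?ypS -?ypP //.
    by apply: (@pbw_in m (d + 1 :: D)).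
  by apply: (@pbw_in m (d - 1 :: D)).
- by rewrite !mulrDr; split; apply: pbwD.
Qed.

(** Since omega = y_1 s_1...s_(n-1), stability under y_1, its inverse, the s_j and the T_j
    suffices. *)
Lemma pbw_om x : (0 < n)%N -> pbw n x -> pbw n (om * x) /\ pbw n (omi * x).
Proof.
move=> n0 px; have vI : all (fun j => 0 < j < n)%N (iota 1 n.-1).
  by apply/allP => j; rewrite mem_iota; lia.
have omE : om = y 1 * sw (iota 1 n.-1) by rewrite y1E -mulrA tw_swK ?mulr1.
have omiE : omi = tw (rev (iota 1 n.-1)) * yi 1.
  rewrite -[RHS]mul1r -(Kom n0) -mulrA (mulrA om) -y1E yK ?mulr1 //.
split; rewrite (omE, omiE) -mulrA.
  apply: (pbw_y1 n0 _).1; elim: (iota 1 n.-1) vI => [|j J IH] /=.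
    by rewrite sw_nil mul1r.
  by case/andP=> lj /IH pJ; rewrite sw_cons -mulrA; apply: pbw_s.
move: vI; rewrite -all_rev; elim: (rev _) => [|j J IH] /=.
  by rewrite tw_nil mul1r => _; apply: (pbw_y1 n0 px).2.
by case/andP=> lj /IH pJ; rewrite tw_cons -mulrA; apply: pbw_t.
Qed.

Lemma pbw_evw w : valid n w -> pbw n (evw w).
Proof.
elim: w => [|x w IH] /=.
  have Y0 m o : Ys o (nseq m 0) = 1 by elim: m o => //= m IH o; rewrite IH mulr1.
  rewrite evw_nil => _; rewrite -[1](Y0 n 0%N) -[Ys _ _]mulr1; apply: pbw_in (fin1 n).
  by rewrite size_nseq.
case/andP=> vx /IH {IH}; rewrite evw_cons; set p := evw w.
have nn : (n <= n)%N by [].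
(* T_0 lies outside the finite algebra; conjugation by omega reduces it to T_(n-1). *)
have pt0 : (1 < n)%N -> t 0 = om * t n.-1 * omi /\ s 0 = om * s n.-1 * omi.
  move=> n1; have E : om * t n.-1 = t 0 * om.
    by rewrite om_t ?prednK ?modnn //; lia.
  split; first by rewrite E -mulrA omK ?mulr1 //; lia.
  rewrite -[LHS]mulr1 -(omK (ltnW n1)) mulrA; congr (_ * _).
  rewrite -[RHS]mul1r -(@Kt 0) //; last by lia.
  by rewrite -mulrA; congr (_ * _); rewrite mulrA -E -mulrA tK ?mulr1 //; lia.
case: x vx => [j|j|||| ] /= vx pw.
- case: j vx => [|j] vx; last by apply: pbw_t => //; lia.
  have [-> _] := pt0 (proj1 (andP vx)).
  rewrite -!mulrA; apply: (pbw_om _ _).1; first by lia.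
  by apply: pbw_t; [| lia | apply: (pbw_om _ _).2 => //; lia].
- case: j vx => [|j] vx; last by apply: pbw_s => //; lia.
  have [_ ->] := pt0 (proj1 (andP vx)).
  rewrite -!mulrA; apply: (pbw_om _ _).1; first by lia.
  by apply: pbw_s; [| lia | apply: (pbw_om _ _).2 => //; lia].
- exact: (pbw_om vx pw).1.
- exact: (pbw_om vx pw).2.
- by apply: pbw_central central_q _ pw => h; apply: finq.
- by apply: pbw_central central_qi _ pw => h; apply: finqi.
Qed.

(** * Spanning of the cocenter *)

Section Cocenter.
(** [Q] will say that all multiples of x by powers of q and q^-1 have their trace in the image. The
    commutation hypotheses in [Qcyc] allow these powers to be carried past x before rotating. *)
Variable Q : A -> Prop.
Hypotheses (Q0 : Q 0) (QD : forall x x', Q x -> Q x' -> Q (x + x')).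
Hypotheses (QN : forall x, Q x -> Q (- x)).
Hypotheses (Qq : forall x, Q x -> Q (q * x)) (Qqi : forall x, Q x -> Q (qi * x)).
Hypothesis Qcyc : forall x x', GRing.comm q x -> GRing.comm qi x ->
  Q (x * x') -> Q (x' * x).
Hypothesis Qbase : forall D J, size D = n -> sorted ltn J ->
  all (fun j => 0 < j < n)%N J -> Q (Ys 0 D * tw J).

(** The letters of [J] are at least m, so prepending m whenever T_m occurs keeps [J] increasing, as
    [blocks_exist] requires. At m = 0 the factor from the finite algebra is a scalar. *)
Lemma cocenter_pbw m J x : (m <= n)%N -> sorted ltn J ->
  all (fun j => 0 < j < n)%N J -> all (leq m) J -> pbw m x -> Q (x * tw J).
Proof.
elim: m J x => [|m IH] J x lmn sJ vJ mJ; last first.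
  elim=> [D h sD fh|u v _ IHu _ IHv]; last by rewrite mulrDl; apply: QD.
  have mJ' : all (leq m) J by apply: sub_all mJ => j; exact: ltnW.
  elim: (fin_bruhat lmn fh) => {h fh} [h fh|a b m0 fa fb|u v _ IHu _ IHv].
  - by apply: IH => //; [lia | apply: pbw_in].
  - have cJ : GRing.comm (tw J) b by apply: tw_fin_comm fb => //; lia.
    rewrite mulrA -mulrA -cJ mulrA; apply: Qcyc.
    + by apply: fin_comm fb => [||j lj] //; [rewrite /GRing.comm qK Kq |
        apply: q_central => /=; lia].
    + by apply: fin_comm fb => [||j lj] //; [rewrite /GRing.comm qK Kq |
        apply: qi_central => /=; lia].
    rewrite (_ : b * _ = b * (Ys 0 D * a) * tw (m :: J)); last first.
      by rewrite tw_cons !mulrA.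
    apply: IH => //=; rewrite ?leqnn ?vJ ?andbT ?lmn ?m0 //.
    + by lia.
    + by rewrite path_sortedE ?sJ ?andbT //; exact: ltn_trans.
    + by apply: fin_pbw => //; [lia | apply: pbw_in].
  - by rewrite mulrDr mulrDl; apply: QD.
elim=> [D h sD|u v _ IHu _ IHv]; last by rewrite mulrDl; apply: QD.
elim=> [||u v _ IHu _ IHv|u _ IHu|u _ IHu|u _ IHu|j u lj _ IHu]; last by lia.
- by rewrite mulr0 mul0r.
- by rewrite mulr1; apply: Qbase.
- by rewrite mulrDr mulrDl; apply: QD.
- by rewrite mulrN mulNr; apply: QN.
- by rewrite mulrA -(central_Ys central_q) ?sD // -!mulrA; apply: Qq; rewrite mulrA.
- by rewrite mulrA -(central_Ys central_qi) ?sD // -!mulrA; apply: Qqi; rewrite mulrA.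
Qed.

Lemma cocenter_words w : valid n w -> Q (evw w).
Proof.
by move=> vw; rewrite -[evw w]mulr1 -tw_nil; apply: cocenter_pbw (pbw_evw vw).
Qed.

End Cocenter.

Lemma trace_span (V : zmodType) (tau : {additive A -> V}) (Im : V -> Prop) :
  (forall x y, tau (x * y) = tau (y * x)) ->
  Im 0 -> (forall v v', Im v -> Im v' -> Im (v + v')) -> (forall v, Im v -> Im (- v)) ->
  (forall e f D J, size D = n -> sorted ltn J -> all (fun j => 0 < j < n)%N J ->
     Im (tau (q ^+ e * qi ^+ f * (Ys 0 D * tw J)))) ->
  forall w, valid n w -> Im (tau (evw w)).
Proof.
move=> tauC Im0 ImD ImN Imb w vw.
(* [Im] is only a subgroup; quantifying over the powers builds stability under q into [Q]. *)
pose Q x := forall e f, Im (tau (q ^+ e * qi ^+ f * x)).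
suff /(_ 0%N 0%N) : Q (evw w) by rewrite !expr0 !mul1r.
apply: cocenter_words vw => {w}.
- by move=> e f; rewrite mulr0 raddf0.
- by move=> x x' Qx Qx' e f; rewrite mulrDr raddfD; apply: ImD; [apply: Qx | apply: Qx'].
- by move=> x Qx e f; rewrite mulrN raddfN; apply: ImN; apply: Qx.
- move=> x Qx e f; have := Qx e.+1 f.
  by rewrite exprSr -(mulrA _ q) (commrX f q_qi_comm) !mulrA.
- by move=> x Qx e f; have := Qx e f.+1; rewrite exprSr !mulrA.
- move=> x x' cq cqi Qx e f; have := Qx e f.
  have cx : GRing.comm x (q ^+ e * qi ^+ f).
    by apply: commrM; apply: commrX; exact: commr_sym.
  by rewrite mulrA -cx -mulrA tauC mulrA.
- by move=> D J sD sJ vJ e f; apply: Imb.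
Qed.

End AffineHecke.

(** * The quotient algebra and its cocenter *)

Section LinearExtension.
Variables (K : choiceType) (V : zmodType) (f : K -> V).

Definition linext (x : {malg int[K]}) : V := \sum_(k <- msupp x) f k *~ x@_k.

Lemma linextEw (D : {fset K}) x : (msupp x `<=` D)%fset ->
  linext x = \sum_(k <- D) f k *~ x@_k.
Proof.
move=> le; rewrite /linext (big_fset_incl _ le) //= => k _ /mcoeff_outdom ->.
by rewrite mulr0z.
Qed.

Lemma linext_is_zmod_morphism : zmod_morphism linext.
Proof.
move=> x y; pose D := (msupp x `|` msupp y)%fset.
rewrite !(@linextEw D) ?fsubsetUl ?fsubsetUr ?msuppB_le // -sumrB.
by apply: eq_bigr => k _; rewrite mcoeffB mulrzBr.
Qed.

HB.instance Definition _ :=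
  GRing.isZmodMorphism.Build {malg int[K]} V linext linext_is_zmod_morphism.

Lemma linextU k c : linext << c *g k >> = f k *~ c.
Proof. by rewrite (linextEw msuppU_le) big_seq_fset1 mcoeffUU. Qed.

Lemma linext0 : linext 0 = 0. Proof. exact: raddf0. Qed.

Lemma linextB x x' : linext (x - x') = linext x - linext x'.
Proof. exact: raddfB. Qed.

End LinearExtension.

Section SpanQuotient.
Variables (V : zmodType) (S : V -> Prop).

(** The quotient construction takes a boolean predicate, while membership in the span is a
    proposition; informative excluded middle bridges the two. *)
Definition spanb : {pred V} :=
  fun x => if excluded_middle_informative (zspan S x) then true else false.

Lemma spanP x : reflect (zspan S x) (x \in spanb).
Proof. by rewrite unfold_in; case: excluded_middle_informative => H; constructor. Qed.

Lemma zspan0 : zspan S 0.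
Proof. by exists [::]; split=> //; rewrite big_nil. Qed.

Lemma zspan_gen x : S x -> zspan S x.
Proof.
move=> Sx; exists [:: (1, x)]; split; last by rewrite big_seq1.
by move=> p [<-|[]].
Qed.

Lemma zspanB x x' : zspan S x -> zspan S x' -> zspan S (x - x').
Proof.
case=> l [Sl ->] [l' [Sl' ->]].
exists (l ++ [seq (- p.1, p.2) | p <- l']); split.
  move=> p /(@Stdlib.Lists.List.in_app_or _ _ _ _)[/Sl //|].
  by case/Stdlib.Lists.List.in_map_iff => p' [<- /Sl'].
rewrite big_cat big_map -sumrN; congr (_ + _).
by apply: eq_bigr => p _; rewrite mulrNz.
Qed.

Lemma spanb_zmod_closed : zmod_closed spanb.
Proof.
split; first exact/spanP/zspan0.
by move=> x x' /spanP Sx /spanP Sx'; apply/spanP/zspanB.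
Qed.

HB.instance Definition _ := GRing.isZmodClosed.Build V spanb spanb_zmod_closed.

Lemma zspan_ind (P : V -> Prop) : P 0 -> (forall x x', P x -> P x' -> P (x - x')) ->
  (forall x, S x -> P x) -> forall x, zspan S x -> P x.
Proof.
move=> P0 PB PS x [l [Sl ->]].
have PN u : P u -> P (- u) by move=> Pu; rewrite -sub0r; apply: PB.
have PD u u' : P u -> P u' -> P (u + u').
  by move=> Pu Pu'; rewrite -[u']opprK; apply/PB/PN.
have PMn u k : P u -> P (u *+ k).
  by move=> Pu; elim: k => [|k IH]; rewrite ?mulr0n ?mulrS //; apply: PD.
elim: l Sl => [|[c u] l IH] Sl; first by rewrite big_nil.
rewrite big_cons; apply: PD; last by apply: IH => p pl; apply: Sl; right.
have Pu : P u by apply: PS; exact: (Sl (c, u) (or_introl erefl)).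
by case: c {Sl} => k; rewrite /= ?NegzE ?mulrNz; [apply: PMn | apply/PN/PMn].
Qed.

Definition spanq := Quotient.quot spanb.
HB.instance Definition _ := GRing.Zmodule.on spanq.

Definition qpi (x : V) : spanq := \pi_(Quotient.quot spanb) x.

Lemma qpi_is_zmod_morphism : zmod_morphism qpi.
Proof. exact: pi_is_zmod_morphism. Qed.

HB.instance Definition _ :=
  GRing.isZmodMorphism.Build V spanq qpi qpi_is_zmod_morphism.

Lemma qpiP x x' : qpi x = qpi x' <-> zspan S (x - x').
Proof.
split=> [/eqP|H].
  by rewrite -Quotient.idealrBE => /spanP.
by apply/eqP; rewrite -Quotient.idealrBE; apply/spanP.
Qed.

Definition qrepr (x : spanq) : V := repr (x : Quotient.quot spanb).

Lemma qreprK x : qpi (qrepr x) = x.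
Proof. exact: (@reprK V (Quotient.quot spanb) x). Qed.

End SpanQuotient.

Lemma malgU_intr (K : choiceType) (k : K) (c : int) :
  << c *g k >> = << k >> *~ c :> {malg int[K]}.
Proof. by rewrite -raddfMz /= intz. Qed.

Lemma malg_ind (K : choiceType) (P : {malg int[K]} -> Prop) :
  P 0 -> (forall x x', P x -> P x' -> P (x - x')) -> (forall k, P << k >>) ->
  forall x, P x.
Proof.
move=> P0 PB PU x; apply: (@zspan_ind _ (fun x' => exists k, x' = << k >>)) => //.
  by move=> _ [k ->].
exists [seq (x@_k, << k >>) | k <- msupp x]; split.
  by move=> p /(@Stdlib.Lists.List.in_map_iff _ _ _ _ _)[k [<- _]]; exists k.
by rewrite big_map [LHS]monalgE; apply: eq_bigr => k _ /=; rewrite malgU_intr.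
Qed.

(** The last axiom of the monoid structure on words, through which [FW] becomes the free ring on the
    letters. *)
Lemma seqBG_unitm (u v : seq BG) : u ++ v = [::] -> u = [::] /\ v = [::].
Proof. by case: u. Qed.

HB.instance Definition _ := Choice_isMonomialDef.Build (seq BG)
  (@catA BG) (@cat0s BG) (@cats0 BG) seqBG_unitm.

Definition FW := {malg int[seq BG]}.
HB.instance Definition _ := GRing.NzRing.on FW.

Lemma malgUU (u v : seq BG) : (<< u >> : FW) * << v >> = << u ++ v >>.
Proof. by rewrite (malgMEw msuppU_le msuppU_le) !big_seq_fset1 !mcoeffUU mulr1. Qed.

Definition lcW (r : lcomb BG) : FW := \sum_(p <- r) << p.1 *g p.2 >>.

(* Letters that do not belong to AH_n stay free here, so [q] commutes only with
   the valid words; the trace is unaffected. *)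
Definition relgen (n : nat) (x : FW) : Prop :=
  exists a r b, RelB n r /\ x = a * lcW r * b.

Definition AH (n : nat) := spanq (relgen n).

HB.instance Definition _ := GRing.Zmodule.on FB.
(** The degree n is part of each basis word, so this single quotient is the whole direct sum of the
    cocenters. *)
Definition trq := spanq GenKerB.
HB.instance Definition _ := GRing.Zmodule.on trq.
Definition trpi (x : FB) : trq := qpi GenKerB x.
HB.instance Definition _ := GRing.isZmodMorphism.Build FB trq trpi
  (@qpi_is_zmod_morphism FB GenKerB).

Section Algebra.
Variable n : nat.

HB.instance Definition _ := GRing.Zmodule.on (AH n).

Definition cls (x : FW) : AH n := qpi (relgen n) x.
HB.instance Definition _ := GRing.isZmodMorphism.Build FW (AH n) cls
  (@qpi_is_zmod_morphism FW (relgen n)).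

Definition ahmul (x x' : AH n) : AH n := cls (qrepr x * qrepr x').

Lemma relgenM a x b : zspan (relgen n) x -> zspan (relgen n) (a * x * b).
Proof.
apply: (zspan_ind (P := fun x => zspan (relgen n) (a * x * b))).
- by rewrite mulr0 mul0r; apply: zspan0.
- by move=> u u' Iu Iu'; rewrite mulrBr mulrBl; apply: zspanB.
- move=> _ [a' [r [b' [Rr ->]]]]; apply: zspan_gen.
  by exists (a * a'), r, (b' * b); split=> //; rewrite !mulrA.
Qed.

Lemma clsM x x' : cls (x * x') = ahmul (cls x) (cls x').
Proof.
have Ecls u : zspan (relgen n) (u - qrepr (cls u)) by apply/qpiP; rewrite qreprK.
apply/qpiP; set u := qrepr _; set u' := qrepr _.
have -> : x * x' - u * u' = 1 * (x - u) * x' - u * (u' - x') * 1.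
  by rewrite mul1r mulr1 mulrBl mulrBr opprB addrA subrK.
apply: zspanB; apply: relgenM; first exact: Ecls.
by rewrite -opprB -sub0r; apply: zspanB; [apply: zspan0 | apply: Ecls].
Qed.

Lemma clsP x : exists u, x = cls u.
Proof. by exists (qrepr x); rewrite /cls qreprK. Qed.

Lemma ahmulA : associative ahmul.
Proof.
move=> x1 x2 x3; have [[u1 ->] [u2 ->] [u3 ->]] := And3 (clsP x1) (clsP x2) (clsP x3).
by rewrite -!clsM mulrA.
Qed.

Lemma ahmul1l : left_id (cls 1) ahmul.
Proof. by move=> x; have [u ->] := clsP x; rewrite -clsM mul1r. Qed.

Lemma ahmul1r : right_id (cls 1) ahmul.
Proof. by move=> x; have [u ->] := clsP x; rewrite -clsM mulr1. Qed.

Lemma ahmulDl : left_distributive ahmul +%R.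
Proof.
move=> x1 x2 x3; have [[u1 ->] [u2 ->] [u3 ->]] := And3 (clsP x1) (clsP x2) (clsP x3).
by rewrite -!clsM -!raddfD -clsM mulrDl.
Qed.

Lemma ahmulDr : right_distributive ahmul +%R.
Proof.
move=> x1 x2 x3; have [[u1 ->] [u2 ->] [u3 ->]] := And3 (clsP x1) (clsP x2) (clsP x3).
by rewrite -!clsM -!raddfD -clsM mulrDr.
Qed.

HB.instance Definition _ := GRing.Zmodule_isPzRing.Build (AH n)
  ahmulA ahmul1l ahmul1r ahmulDl ahmulDr.

Definition gen (x : BG) : AH n := cls << [:: x] >>.

Lemma evw_gen w : evw gen w = cls << w >>.
Proof.
elim: w => [|x w IH]; first by rewrite /evw big_nil.
by rewrite /evw big_cons -/(evw gen w) IH -[RHS]/(cls << [:: x] ++ w >>) -malgUU clsM.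
Qed.

Lemma gen_satisfies : satisfies n gen.
Proof.
move=> r Rr; transitivity (cls (lcW r)).
  rewrite raddf_sum; apply: eq_bigr => p _; rewrite evw_gen malgU_intr.
  exact/esym/raddfMz.
rewrite -(raddf0 cls); apply/qpiP; rewrite subr0; apply: zspan_gen.
by exists 1, r, 1; rewrite mul1r mulr1.
Qed.

Definition trW (x : FW) : trq := linext (fun w => trpi (wB n w)) x.
HB.instance Definition _ := GRing.isZmodMorphism.Build FW trq trW
  (@linext_is_zmod_morphism _ _ _).

Lemma trWU w : trW << w >> = trpi (wB n w).
Proof. by rewrite /trW linextU mulr1z. Qed.

Lemma trWB x x' : trW (x - x') = trW x - trW x'.
Proof. exact: raddfB. Qed.

(** Makes [tr] well defined on [AH n]: by additivity the outer factors may be taken to be words, and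
    a relation between two words is a generator of the kernel. *)
Lemma trW_rel x : zspan (relgen n) x -> trW x = 0.
Proof.
apply: (zspan_ind (P := fun u => trW u = 0)) => [|u u' IHu IHu'|_ [a [r [b [Rr ->]]]]].
- exact: raddf0.
- by rewrite trWB IHu IHu' subr0.
elim/malg_ind: a => [|a a' IHa IHa'|a].
- by rewrite !mul0r raddf0.
- by rewrite !mulrBl trWB IHa IHa' subr0.
elim/malg_ind: b => [|b b' IHb IHb'|b].
- by rewrite !mulr0 raddf0.
- by rewrite !mulrBr trWB IHb IHb' subr0.
transitivity (trpi (lcB n (sandwich a r b))); last first.
  rewrite -(raddf0 trpi); apply/qpiP; rewrite subr0; apply: zspan_gen.
  by right; left; exists n, a, r, b.
rewrite /lcB /lcW /sandwich big_map mulr_sumr mulr_suml !raddf_sum.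
apply: eq_bigr => p _ /=; rewrite (malgU_intr p.2) mulrzAr mulrzAl !malgUU -catA.
by rewrite (malgU_intr (n, _)) !raddfMz; congr (_ *~ _); exact: trWU.
Qed.

Definition tr (x : AH n) : trq := trW (qrepr x).

Lemma tr_cls x : tr (cls x) = trW x.
Proof.
apply/eqP; rewrite -subr_eq0 -trWB; apply/eqP; apply: trW_rel.
by apply/qpiP; rewrite qreprK.
Qed.

Lemma tr_is_zmod_morphism : zmod_morphism tr.
Proof.
move=> x x'; have [[u ->] [u' ->]] := conj (clsP x) (clsP x').
by rewrite -raddfB !tr_cls trWB.
Qed.

HB.instance Definition _ :=
  GRing.isZmodMorphism.Build (AH n) trq tr tr_is_zmod_morphism.

Lemma trC x x' : tr (x * x') = tr (x' * x).
Proof.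
have [[u ->] [u' ->]] := conj (clsP x) (clsP x').
rewrite -[cls u * _]clsM -[cls u' * _]clsM !tr_cls.
elim/malg_ind: u => [|a a' IHa IHa'|a].
- by rewrite mul0r mulr0.
- by rewrite mulrBl mulrBr !trWB IHa IHa'.
elim/malg_ind: u' => [|b b' IHb IHb'|b].
- by rewrite mul0r mulr0.
- by rewrite mulrBl mulrBr !trWB IHb IHb'.
rewrite !malgUU !trWU; apply/qpiP; apply: zspan_gen.
by right; right; exists n, a, b.
Qed.

Lemma tr_evw w : tr (evw gen w) = trpi (wB n w).
Proof. by rewrite evw_gen tr_cls trWU. Qed.

End Algebra.

Lemma trpiP x x' : trpi x = trpi x' <-> eqB x x'.
Proof. exact: qpiP. Qed.

(** * Juxtaposition of blocks of strands *)

Section BlockEmbedding.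
Variables (A : pzRingType) (N : nat) (ev : BG -> A).
Hypothesis evR : satisfies N ev.
Local Notation twN := (tw ev).
Local Notation swN := (sw ev).
Local Notation yN := (yelt N ev).
Local Notation yiN := (yinv N ev).

Lemma y_climb b m : (b + m < N)%N ->
  swN (rev (iota b.+1 m)) * (yN b.+1 * swN (iota b.+1 m)) = yN (b.+1 + m).
Proof.
elim: m => [|m IH] lN; first by rewrite sw_nil mul1r mulr1 addn0.
rewrite rev_iotaS iotaSr sw_cons sw_cat sw_cons sw_nil mulr1 addnS [RHS](yS evR); last by lia.
by rewrite -IH ?mulrA //; lia.
Qed.

Lemma yi_climb b m : (b + m < N)%N ->
  twN (rev (iota b.+1 m)) * (yiN b.+1 * twN (iota b.+1 m)) = yiN (b.+1 + m).
Proof.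
elim: m => [|m IH] lN; first by rewrite tw_nil mul1r mulr1 addn0.
rewrite rev_iotaS iotaSr tw_cons tw_cat tw_cons tw_nil mulr1 addnS [RHS](yiS evR); last by lia.
by rewrite -IH ?mulrA //; lia.
Qed.

Section Block.
(* The block of strands [b + 1, ..., M]. *)
Variables (b M i : nat).
Hypotheses (lbi : (b < i <= M)%N) (lMN : (M <= N)%N).

Let splitM : iota b.+1 (M - b.+1) = iota b.+1 (i - b.+1) ++ iota i (M - i).
Proof.
have -> : (M - b.+1 = (i - b.+1) + (M - i))%N by lia.
by rewrite iotaD subnKC //; lia.
Qed.

Let okM : all (fun j => 0 < j < N)%N (iota i (M - i)).
Proof. by apply/allP=> j; rewrite mem_iota; lia. Qed.

(** The defining word of y_i with omega replaced by its image y_(b+1) s_(b+1)...s_(M-1). The tail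
    s_i...s_(M-1) cancels against T_(M-1)...T_i, and the rest climbs from b + 1 to i. *)
Lemma y_block :
  swN (rev (iota b.+1 (i - b.+1))) *
    (yN b.+1 * swN (iota b.+1 (M - b.+1)) * twN (rev (iota i (M - i)))) = yN i.
Proof.
rewrite splitM sw_cat -!mulrA (sw_twK evR okM) mulr1 y_climb; last by lia.
by congr yN; lia.
Qed.

Lemma yi_block :
  swN (iota i (M - i)) *
    (twN (rev (iota b.+1 (M - b.+1))) * yiN b.+1 * twN (iota b.+1 (i - b.+1))) = yiN i.
Proof.
rewrite splitM rev_cat tw_cat !mulrA (sw_twK evR okM) mul1r -!mulrA yi_climb; last by lia.
by congr yiN; lia.
Qed.

End Block.

Lemma Ys_transfer n ev' o o' D :
  (forall i, (o < i <= o + size D)%N ->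
     yelt n ev' i = yN (o' + (i - o)) /\ yinv n ev' i = yiN (o' + (i - o))) ->
  Ys n ev' o D = Ys N ev o' D.
Proof.
elim: D o o' => [|d D IH] o o' H //=.
have [E1 E2] := H o.+1 ltac:(rewrite /=; lia).
rewrite /yp E1 E2 (_ : (o' + (o.+1 - o))%N = o'.+1); last by lia.
congr (_ * _); apply: IH => i li.
by rewrite (_ : (o'.+1 + (i - o.+1))%N = (o' + (i - o))%N); [apply: H => /=; lia | lia].
Qed.

Section Left.
Variable n : nat.
Hypothesis lnN : (n <= N)%N.
Let ev1 x := evw ev (iota1 n N x).

(** The letter 0 is excluded because [iota1] sends it to a conjugate, not to a letter. *)
Lemma tw_left J : all (leq 1) J -> tw ev1 J = twN J.
Proof.
elim: J => [|[|j] J IH] //=; rewrite ?tw_nil // => /IH E.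
by rewrite !tw_cons E /ev1 /= evw_cons evw_nil mulr1.
Qed.

Lemma sw_left J : all (leq 1) J -> sw ev1 J = swN J.
Proof.
elim: J => [|[|j] J IH] //=; rewrite ?sw_nil // => /IH E.
by rewrite !sw_cons E /ev1 /= evw_cons evw_nil mulr1.
Qed.

Let pos_iota o m : all (leq 1) (iota o.+1 m).
Proof. by apply/allP => j; rewrite mem_iota; lia. Qed.

Lemma Ys_left D : (size D <= n)%N -> Ys n ev1 0 D = Ys N ev 0 D.
Proof.
move=> sD; apply: Ys_transfer => -[|i] // li; rewrite add0n subn0.
rewrite yE yiE !sw_left ?tw_left ?all_rev ?subn1 //.
have -> : ev1 Om = yN 1 * swN (iota 1 n.-1) by rewrite /ev1 /= evw_cat evw_sw subn1.
have -> : ev1 Omi = twN (rev (iota 1 n.-1)) * yiN 1.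
  by rewrite /ev1 /= evw_cat evw_tw subn1.
have lbi : (0 < i.+1 <= n)%N by lia.
by split; [rewrite -(y_block lbi lnN) | rewrite -(yi_block lbi lnN)]; rewrite !subn1.
Qed.

End Left.

Section Right.
Variables n k : nat.
Hypothesis NE : N = (n + k)%N.
Let ev2 x := evw ev (iota2 n N x).

Lemma tw_right J : all (leq 1) J -> tw ev2 J = twN [seq (n + j)%N | j <- J].
Proof.
elim: J => [|[|j] J IH] //=; rewrite ?tw_nil // => /IH E.
by rewrite !tw_cons E /ev2 /= evw_cons evw_nil mulr1 addnC.
Qed.

Lemma sw_right J : all (leq 1) J -> sw ev2 J = swN [seq (n + j)%N | j <- J].
Proof.
elim: J => [|[|j] J IH] //=; rewrite ?sw_nil // => /IH E.
by rewrite !sw_cons E /ev2 /= evw_cons evw_nil mulr1 addnC.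
Qed.

Let pos_iota o m : all (leq 1) (iota o.+1 m).
Proof. by apply/allP => j; rewrite mem_iota; lia. Qed.

Lemma Ys_right D : (size D <= k)%N -> Ys k ev2 0 D = Ys N ev n D.
Proof.
move=> sD; apply: Ys_transfer => -[|i] // li; rewrite subn0.
rewrite yE yiE !sw_right ?tw_right ?all_rev // !map_rev -!iotaDl addn1 addnS.
have -> : ev2 Om = yN n.+1 * swN (iota n.+1 (N - n.+1)) by rewrite /ev2 /= evw_cat evw_sw.
have -> : ev2 Omi = twN (rev (iota n.+1 (N - n.+1))) * yiN n.+1.
  by rewrite /ev2 /= evw_cat evw_tw.
have lbi : (n < (n + i).+1 <= N)%N by lia.
have [e1 e2] : (i.+1 - 1 = (n + i).+1 - n.+1)%N /\ (k - i.+1 = N - (n + i).+1)%N by lia.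
by rewrite e1 e2; split; [rewrite -(y_block lbi (leqnn N)) | rewrite -(yi_block lbi (leqnn N))].
Qed.

End Right.
End BlockEmbedding.

(** * The homomorphism and its relations *)

Fixpoint dcat (u : seq AG) : seq int :=
  match u with
  | [::] => [::]
  | E d0 ds :: u' => (d0 :: ds) ++ dcat u'
  | _ :: u' => dcat u'
  end.

(** [ds] is one entry shorter than the index sequence, which gives the power q^(1-n) of the
    generator. *)
Fixpoint qpart (u : seq AG) : seq BG :=
  match u with
  | [::] => [::]
  | E _ ds :: u' => nseq (size ds) Qbi ++ qpart u'
  | Qa :: u' => Qb :: qpart u'
  | Qai :: u' => Qbi :: qpart u'
  end.

(** Each block contributes the Coxeter element of its own strands; the index joining its last strand
    to the next block is skipped. *)
Fixpoint jpart (o : nat) (u : seq AG) : seq nat :=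
  match u with
  | [::] => [::]
  | E _ ds :: u' => iota o.+1 (size ds) ++ jpart (o + (size ds).+1) u'
  | _ :: u' => jpart o u'
  end.

Definition ypart (N : nat) (D : seq int) : seq BG :=
  flatten [seq ypow N i.+1 (nth 0 D i) | i <- iota 0 (size D)].

Definition rank (u : seq AG) := size (dcat u).

Definition phi (u : seq AG) : seq BG :=
  qpart u ++ ypart (rank u) (dcat u) ++ [seq Sg j | j <- jpart 0 u].

Lemma dcat_cat u v : dcat (u ++ v) = dcat u ++ dcat v.
Proof. by elim: u => [|[d0 ds||] u IH] //=; rewrite IH catA. Qed.

Lemma qpart_cat u v : qpart (u ++ v) = qpart u ++ qpart v.
Proof. by elim: u => [|[d0 ds||] u IH] //=; rewrite IH ?catA. Qed.

Lemma jpart_cat o u v : jpart o (u ++ v) = jpart o u ++ jpart (o + rank u) v.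
Proof.
rewrite /rank; elim: u o => [|[d0 ds||] u IH] o //=; rewrite ?addn0 // IH -catA.
by rewrite size_cat; congr (_ ++ (_ ++ jpart _ _)); lia.
Qed.

Lemma jpart_shift o o' u : jpart (o + o') u = [seq (o + j)%N | j <- jpart o' u].
Proof.
elim: u o' => [|[d0 ds||] u IH] o' //=.
by rewrite map_cat -IH -iotaDl; congr (iota _ _ ++ jpart _ _); lia.
Qed.

Lemma jpart_bound o u : all (fun j => o < j < o + rank u)%N (jpart o u).
Proof.
rewrite /rank; elim: u o => [|[d0 ds||] u IH] o //=; rewrite all_cat size_cat.
apply/andP; split; first by apply/allP=> j; rewrite mem_iota; lia.
by apply: sub_all (IH _) => j; lia.
Qed.

Lemma dcat_Ew d : dcat (Ew d) = d.
Proof. by case: d => //= d0 ds; rewrite cats0. Qed.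

Lemma qpart_Ew d : qpart (Ew d) = nseq (size d).-1 Qbi.
Proof. by case: d => //= d0 ds; rewrite cats0. Qed.

Lemma jpart_Ew o d : jpart o (Ew d) = iota o.+1 (size d).-1.
Proof. by case: d => //= d0 ds; rewrite cats0. Qed.

Lemma valid_qpart n u : valid n (qpart u).
Proof.
elim: u => [|[d0 ds||] u IH] //=; rewrite /valid all_cat; apply/andP; split=> //.
by apply/allP=> x; rewrite mem_nseq => /andP[_ /eqP ->].
Qed.

Lemma evw_ypart (A : pzRingType) (ev : BG -> A) N D :
  evw ev (ypart N D) = Ys N ev 0 D.
Proof.
suff H o : evw ev (flatten [seq ypow N (o + i).+1 (nth 0 D i) | i <- iota 0 (size D)]) =
    Ys N ev o D by exact: (H 0%N).
elim: D o => [|d D IH] o /=; first by rewrite evw_nil.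
rewrite evw_cat addn0 evw_ypow -IH (iotaDl 1 0) -map_comp; congr (_ * evw _ _).
by congr flatten; apply: eq_map => i /=; rewrite addnCA add1n.
Qed.

Lemma evw_phi (A : pzRingType) (ev : BG -> A) n u : rank u = n ->
  evw ev (phi u) = evw ev (qpart u) * Ys n ev 0 (dcat u) * tw ev (jpart 0 u).
Proof. by move=> <-; rewrite /phi !evw_cat evw_ypart evw_tw mulrA. Qed.

Lemma valid_phi u : valid (rank u) (phi u).
Proof.
rewrite /phi /valid !all_cat -/(valid _ _) valid_qpart all_map /=; apply/andP; split.
  rewrite /ypart; apply/allP=> x /flattenP[w /mapP[i]]; rewrite mem_iota => li ->.
  by move: x; apply/allP; apply: valid_ypow; rewrite /rank; lia.
by apply: sub_all (jpart_bound 0 u) => j /=; lia.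
Qed.

Definition pv (u : seq AG) : trq := trpi (wB (rank u) (phi u)).

Lemma pvE n u : rank u = n ->
  pv u = tr (evw (gen n) (qpart u) * Ys n (gen n) 0 (dcat u) * tw (gen n) (jpart 0 u)).
Proof. by move=> un; rewrite -evw_phi // tr_evw /pv un. Qed.

Lemma pv_eq u u' : dcat u = dcat u' -> jpart 0 u = jpart 0 u' ->
  (forall (A : pzRingType) n (ev : BG -> A), satisfies n ev ->
     evw ev (qpart u) = evw ev (qpart u')) -> pv u = pv u'.
Proof.
move=> Ed Ej Eq; rewrite !(pvE (n := rank u)) /rank -?Ed // Ej.
by rewrite (Eq _ _ _ (@gen_satisfies _)).
Qed.

Lemma evw_map (A : pzRingType) (ev : BG -> A) (f : BG -> seq BG) w :
  evw ev (flatten [seq f x | x <- w]) = evw (fun x => evw ev (f x)) w.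
Proof.
by elim: w => [|x w IH] /=; rewrite ?evw_nil // evw_cat IH evw_cons.
Qed.

Lemma evw_qpart (A : pzRingType) (ev ev' : BG -> A) u :
  ev Qb = ev' Qb -> ev Qbi = ev' Qbi -> evw ev (qpart u) = evw ev' (qpart u).
Proof.
move=> eq eqi; elim: u => [|[d0 ds||] u IH] /=; rewrite ?evw_nil //.
- rewrite !evw_cat IH; congr (_ * _).
  by elim: (size ds) => [|m IHm] /=; rewrite ?evw_nil // !evw_cons IHm eqi.
- by rewrite !evw_cons IH eq.
- by rewrite !evw_cons IH eqi.
Qed.

Lemma qpart_central (A : pzRingType) (ev : BG -> A) n u :
  satisfies n ev -> central n ev (evw ev (qpart u)).
Proof.
move=> evR w vw; apply: commr_sym; elim: u => [|[d0 ds||] u IH] /=.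
- by rewrite evw_nil; apply: commr1.
- rewrite evw_cat; apply: commrM => //.
  elim: (size ds) => [|m IHm] /=; rewrite ?evw_nil ?evw_cons; first exact: commr1.
  by apply: commrM => //; exact: commr_sym (central_qi evR vw).
- by rewrite evw_cons; apply: commrM => //; exact: commr_sym (central_q evR vw).
- by rewrite evw_cons; apply: commrM => //; exact: commr_sym (central_qi evR vw).
Qed.

Lemma all_pos_jpart o u : all (leq 1) (jpart o u).
Proof. by apply: sub_all (jpart_bound o u) => j; lia. Qed.

(** The identity holds before taking traces: the powers of q are central, and the letters T_j of the
    first block commute with the Y_i of the second. *)
Lemma evw_skein (A : pzRingType) (ev : BG -> A) u v (n := rank u) (k := rank v)
    (N := (n + k)%N) : satisfies N ev ->
  evw ev (flatten [seq iota1 n N x | x <- phi u] ++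
          flatten [seq iota2 n N x | x <- phi v]) = evw ev (phi (u ++ v)).
Proof.
move=> evR; have uvn : rank (u ++ v) = N by rewrite /rank dcat_cat size_cat.
rewrite (evw_phi _ uvn) evw_cat !evw_map (evw_phi _ (n := n)) // (evw_phi _ (n := k)) //.
rewrite (@evw_qpart _ _ ev u); [|by rewrite /= evw_cons evw_nil mulr1..].
rewrite (@evw_qpart _ _ ev v); [|by rewrite /= evw_cons evw_nil mulr1..].
rewrite (Ys_left evR (leq_addr _ _)) // (Ys_right evR (erefl _)) //.
rewrite tw_left ?tw_right ?all_pos_jpart // -jpart_shift addn0.
rewrite dcat_cat Ys_cat qpart_cat evw_cat jpart_cat tw_cat !add0n -/n.
set q1 := evw _ (qpart u); set q2 := evw _ (qpart v).
set y1 := Ys _ _ 0 _; set y2 := Ys _ _ n _; set t1 := tw _ _; set t2 := tw _ _.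
have cq2 : central N ev q2 by apply: qpart_central.
have vJ : all (fun j => 0 < j < N)%N (jpart 0 u).
  by apply: sub_all (jpart_bound 0 u) => j; rewrite /N -/n; lia.
have c1 : GRing.comm q2 t1 by apply: central_tw vJ.
have c2 : GRing.comm q2 y1 by apply: central_Ys => //; rewrite -/(rank u) /N -/n; lia.
have c3 : GRing.comm t1 y2.
  apply: comm_Ys => i d; rewrite -/(rank v) -/k => li; apply: comm_yp => //.
    by rewrite /N; lia.
  apply: commr_sym; apply: y_tw_comm => //; first by rewrite /N; lia.
  by apply: sub_all (jpart_bound 0 u) => j; rewrite /N -/n; lia.
rewrite -!mulrA; congr (_ * _); rewrite !mulrA; congr (_ * _).
by rewrite -(mulrA y1) -c1 !mulrA -c2 -!mulrA c3.
Qed.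

Lemma skein_phi u v :
  trpi (skeinW (rank u, phi u) (rank v, phi v)) = pv (u ++ v).
Proof.
rewrite /skeinW /= !valid_phi -tr_evw evw_skein; last exact: gen_satisfies.
by rewrite tr_evw /pv {3}/rank dcat_cat size_cat.
Qed.

Lemma dshift_cat D1 k l D2 :
  dshift (D1 ++ [:: k, l & D2]) (size D1).+1 = D1 ++ [:: k - 1, l + 1 & D2].
Proof.
have n1 : nth 0 (D1 ++ [:: k, l & D2]) (size D1) = k by rewrite nth_cat ltnn subnn.
have n2 : nth 0 (D1 ++ [:: k, l & D2]) (size D1).+1 = l.
  by rewrite nth_cat ltnNge leqnSn subSnn.
rewrite /dshift /= n1 n2; elim: D1 {n1 n2} => //= d D1 IH.
by rewrite IH.
Qed.

Lemma size_cterms k d j p : (j < size d)%N -> p \in cterms k d j ->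
  size p.2 = (size d).+1.
Proof.
move=> ljd; rewrite /cterms; case: ifP => _ /mapP[i _ ->] /=;
  by rewrite size_cat /= size_drop size_takel; lia.
Qed.

(** * The relations of the source under a trace *)

Section Relations.
Variables (A : pzRingType) (n : nat) (ev : BG -> A).
Hypothesis evR : satisfies n ev.
Variables (V : zmodType) (tau : {additive A -> V}).
Hypothesis tauC : forall x y, tau (x * y) = tau (y * x).
Local Notation q := (ev Qb).
Local Notation qi := (ev Qbi).

(** A version of [pv] with the degree n fixed in advance and an arbitrary trace, so that all terms
    of a relation are compared in one ring. *)
Definition val_phi u : V :=
  tau (evw ev (qpart u) * Ys n ev 0 (dcat u) * tw ev (jpart 0 u)).

Lemma evw_nseq x m : evw ev (nseq m x) = ev x ^+ m.
Proof. by elim: m => [|m IH] /=; rewrite ?evw_nil // evw_cons IH exprS. Qed.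

Lemma q_block_central a m b :
  central n ev (evw ev (qpart a) * qi ^+ m * evw ev (qpart b)).
Proof.
move=> w vw; apply: commr_sym; apply: commrM; last first.
  exact: commr_sym (qpart_central b evR vw).
apply: commrM; first exact: commr_sym (qpart_central a evR vw).
by apply: commrX; exact: commr_sym (central_qi evR vw).
Qed.

Lemma q_qpart a : GRing.comm q (evw ev (qpart a)).
Proof. exact: (central_q evR (valid_qpart n a)). Qed.

Lemma qi_qpart a : GRing.comm qi (evw ev (qpart a)).
Proof. exact: (central_qi evR (valid_qpart n a)). Qed.

Lemma val_block a w b D J qw : dcat w = D -> jpart (rank a) w = J ->
  evw ev (qpart w) = qw ->
  val_phi (a ++ w ++ b) =
  tau (evw ev (qpart a) * qw * evw ev (qpart b) * Ys n ev 0 (dcat a ++ D ++ dcat b)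
       * tw ev (jpart 0 a ++ J ++ jpart (rank a + size D) b)).
Proof.
move=> <- <- <-; rewrite /val_phi !qpart_cat !evw_cat !dcat_cat !jpart_cat.
by rewrite add0n mulrA.
Qed.

Lemma val_rel1 a b d i : (0 < i < size d)%N -> (rank a + size d + rank b = n)%N ->
  val_phi (a ++ Ew d ++ b) - val_phi (a ++ (q1w ++ q2w ++ Ew (dshift d i)) ++ b)
  = val_phi (a ++ (Ew (take i d) ++ Ew (drop i d)) ++ b)
    - val_phi (a ++ (q1w ++ Ew (take i d) ++ Ew (drop i d)) ++ b).
Proof.
case/split_pair=> D1 [k [l [D2 [-> <-]]]].
rewrite dshift_cat size_cat => nE; rewrite /= in nE.
have -> : take (size D1).+1 (D1 ++ [:: k, l & D2]) = rcons D1 k.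
  by rewrite -cats1 -cat1s catA take_size_cat // size_cat addn1.
have -> : drop (size D1).+1 (D1 ++ [:: k, l & D2]) = l :: D2.
  by rewrite -cat1s catA drop_size_cat // size_cat addn1.
pose o := rank a; pose m := (size D1 + size D2)%N.
pose C := evw ev (qpart a) * qi ^+ m.+1 * evw ev (qpart b).
have cC : central n ev C by apply: q_block_central.
pose JL := jpart 0 a ++ iota o.+1 (size D1).
pose JR := iota (o + size D1).+2 (size D2) ++ jpart (o + m.+2) b.
have sz : (size (dcat a ++ D1) + (size (D2 ++ dcat b)).+2 <= n)%N.
  by rewrite !size_cat; move: nE; rewrite /rank; lia.
have iE : (size (dcat a ++ D1)).+1 = (o + size D1).+1 by rewrite size_cat.
have okL : all (fun j => 0 < j < (size (dcat a ++ D1)).+1)%N JL.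
  rewrite iE all_cat; apply/andP; split.
    by apply: sub_all (jpart_bound 0 a) => j; rewrite /o; lia.
  by apply/allP=> j; rewrite mem_iota; lia.
have okR : all (fun j => (size (dcat a ++ D1)).+1 < j < n)%N JR.
  rewrite iE all_cat; apply/andP; split.
    by apply/allP=> j; rewrite mem_iota; rewrite /o; lia.
  by apply: sub_all (jpart_bound (o + m.+2) b) => j; rewrite /o /m; lia.
have := skein_split evR tauC k l cC sz okL okR.
rewrite iE (_ : JL ++ _ :: JR = jpart 0 a ++ iota o.+1 m.+1 ++ jpart (o + m.+2) b); last first.
  rewrite (@iota_split o m.+1 (o + size D1).+1); last by rewrite /m; lia.
  rewrite /JL /JR -!catA; congr (_ ++ (iota _ _ ++ _ :: (iota _ _ ++ _))); rewrite /m; lia.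
move=> E; rewrite -!(catA (dcat a)) /= in E.
have qqi j : q * qi ^+ j.+1 = qi ^+ j by rewrite exprS mulrA (qK evR) mul1r.
(* One block of m + 2 strands carries q^-(m+1), two blocks carry q^-m, and (1 - q^-2) q^-m = (q -
   q^-1) q^-(m+1). *)
have qC : (q - qi) * C = evw ev (qpart a) * qi ^+ m * evw ev (qpart b) -
    evw ev (qpart a) * qi ^+ m.+2 * evw ev (qpart b).
  by rewrite mulrBl /C !mulrA q_qpart qi_qpart -!(mulrA (evw ev (qpart a))) qqi -exprS.
have cat3 x y' (D : seq int) : (D1 ++ [:: x, y' & D2]) ++ D = D1 ++ [:: x, y' & D2 ++ D].
  by rewrite -catA.
pose blk D J r := tau (evw ev (qpart a) * qi ^+ r * evw ev (qpart b) *
  Ys n ev 0 (dcat a ++ D ++ dcat b) * tw ev (jpart 0 a ++ J ++ jpart (o + m.+2) b)).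
have blkE w D J r : dcat w = D -> jpart o w = J -> evw ev (qpart w) = qi ^+ r ->
    size D = m.+2 -> val_phi (a ++ w ++ b) = blk D J r.
  by move=> wD wJ wq sD; rewrite (val_block _ wD wJ wq) sD.
have sm (x y' : int) : size (D1 ++ [:: x, y' & D2]) = m.+2 by rewrite size_cat /= !addnS.
(* This is q1 q2 = 1, so the shifted term has the same power of q as the original one. *)
have Q2 : qi * (qi * (q * q)) = 1.
  by rewrite (mulrA qi q) (Kq evR) mul1r (Kq evR).
have H1 : val_phi (a ++ Ew (D1 ++ [:: k, l & D2]) ++ b) =
    blk (D1 ++ [:: k, l & D2]) (iota o.+1 m.+1) m.+1.
  apply: blkE => //; first exact: dcat_Ew.
    by rewrite jpart_Ew sm.
  by rewrite qpart_Ew evw_nseq sm.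
have H2 : val_phi (a ++ (q1w ++ q2w ++ Ew (D1 ++ [:: k - 1, l + 1 & D2])) ++ b) =
    blk (D1 ++ [:: k - 1, l + 1 & D2]) (iota o.+1 m.+1) m.+1.
  apply: blkE => //; first exact: dcat_Ew.
    by rewrite [LHS]jpart_Ew sm.
  rewrite !qpart_cat !evw_cat qpart_Ew evw_nseq sm mulrA.
  by rewrite !evw_cons !evw_nil !mulr1 -(mulrA qi) Q2 mul1r.
have H3 : val_phi (a ++ (Ew (rcons D1 k) ++ Ew (l :: D2)) ++ b) =
    blk (D1 ++ [:: k, l & D2]) (iota o.+1 (size D1) ++ iota (o + size D1).+2 (size D2)) m.
  apply: blkE => //; first by rewrite dcat_cat !dcat_Ew -cats1 -catA.
    by rewrite jpart_cat !jpart_Ew /rank dcat_Ew size_rcons /= addnS.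
  by rewrite qpart_cat evw_cat !qpart_Ew !evw_nseq size_rcons -exprD.
have H4 : val_phi (a ++ (q1w ++ Ew (rcons D1 k) ++ Ew (l :: D2)) ++ b) =
    blk (D1 ++ [:: k, l & D2]) (iota o.+1 (size D1) ++ iota (o + size D1).+2 (size D2)) m.+2.
  apply: blkE => //; first by rewrite !dcat_cat !dcat_Ew -cats1 -catA.
    by rewrite !jpart_cat !jpart_Ew /rank dcat_Ew size_rcons /= addn0 addnS.
  rewrite !qpart_cat !evw_cat !qpart_Ew !evw_nseq !evw_nil !mulr1 size_rcons -exprD.
  by rewrite !evw_cons !evw_nil !mulr1 -mulrA -!exprS.
rewrite {}H1 {}H2 {}H3 {}H4 /blk !cat3 {}E qC !mulrBl raddfB /=.
by rewrite /JL /JR -!catA.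
Qed.

Lemma val_rel2 a b k d : (0 < size d)%N -> (rank a + (size d).+1 + rank b = n)%N ->
  val_phi (a ++ (E k [::] :: Ew d) ++ b) - val_phi (a ++ (Ew d ++ [:: E k [::]]) ++ b)
  = \sum_(p <- flatten [seq cterms k d j | j <- iota 0 (size d)])
      (val_phi (a ++ (q2w ++ Ew p.2) ++ b) - val_phi (a ++ Ew p.2 ++ b)) *~ p.1.
Proof.
move=> d0 nE; pose o := rank a; pose m := size d.
have mE : m = m.-1.+1 by rewrite prednK.
pose C := evw ev (qpart a) * qi ^+ m.-1 * evw ev (qpart b).
have cC : central n ev C by apply: q_block_central.
pose blk D J c := tau (evw ev (qpart a) * c * evw ev (qpart b) *
  Ys n ev 0 (dcat a ++ D ++ dcat b) * tw ev (jpart 0 a ++ J ++ jpart (o + m.+1) b)).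
have blkE w D J c : dcat w = D -> jpart o w = J -> evw ev (qpart w) = c ->
    size D = m.+1 -> val_phi (a ++ w ++ b) = blk D J c.
  by move=> wD wJ wq sD; rewrite (val_block _ wD wJ wq) sD.
have H1 : val_phi (a ++ (E k [::] :: Ew d) ++ b) =
    blk (k :: d) (iota o.+2 m.-1) (qi ^+ m.-1).
  apply: blkE => //=; first by rewrite dcat_Ew.
    by rewrite jpart_Ew addn1.
  by rewrite qpart_Ew evw_nseq.
have H2 : val_phi (a ++ (Ew d ++ [:: E k [::]]) ++ b) =
    blk (rcons d k) (iota o.+1 m.-1) (qi ^+ m.-1).
  apply: blkE => //=; last by rewrite size_rcons.
  - by rewrite dcat_cat dcat_Ew /= cats1.
  - by rewrite jpart_cat jpart_Ew /= cats0.
  - by rewrite qpart_cat qpart_Ew /= cats0 evw_nseq.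
have sz : (size (dcat a) + (size d).+1 + size (dcat b) <= n)%N by rewrite nE.
have okA : all (fun j => 0 < j < size (dcat a))%N (jpart 0 a).
  exact: sub_all (jpart_bound 0 a).
have okB : all (fun j => size (dcat a) + (size d).+1 < j < n)%N (jpart (o + m.+1) b).
  by apply: sub_all (jpart_bound (o + m.+1) b) => j; rewrite -nE /o /m /rank; lia.
rewrite {}H1 {}H2 [LHS](skein_commutator evR tauC k cC sz okA okB d0).
rewrite big_seq [RHS]big_seq; apply: eq_bigr => p /flattenP[c /mapP[j]].
rewrite mem_iota => /andP[_ ljm] -> /(size_cterms ljm) szp; congr (_ *~ _).
have H3 : val_phi (a ++ (q2w ++ Ew p.2) ++ b) =
    blk p.2 (iota o.+1 m) (q * (q * qi ^+ m)).
  apply: blkE => //; first by rewrite dcat_cat dcat_Ew.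
    by rewrite jpart_cat /= jpart_Ew szp addn0.
  by rewrite qpart_cat evw_cat qpart_Ew szp evw_nseq !evw_cons evw_nil mulr1 mulrA.
have H4 : val_phi (a ++ Ew p.2 ++ b) = blk p.2 (iota o.+1 m) (qi ^+ m).
  apply: blkE => //; first exact: dcat_Ew.
    by rewrite jpart_Ew szp.
  by rewrite qpart_Ew szp evw_nseq.
rewrite {}H3 {}H4 /blk -raddfB -!mulrBl; congr (tau (_ * _ * _)).
(* The terms of c_i have m + 1 entries and carry q^-m, while the commutator carries q^(1-m); the
   factors agree because (q^2 - 1) q^-m = (q - q^-1) q^(1-m). *)
have em : qi ^+ m = qi * qi ^+ m.-1 by rewrite -exprS -mE.
rewrite em (mulrA q qi) (qK evR) mul1r -mulrBr -mulrBl /C !mulrA.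
by rewrite (central_z (qpart_central a evR)).
Qed.

End Relations.

Lemma trpiB x x' : trpi (x - x') = trpi x - trpi x'. Proof. exact: raddfB. Qed.

Lemma trpiD x x' : trpi (x + x') = trpi x + trpi x'. Proof. exact: raddfD. Qed.
Lemma trpiN x : trpi (- x) = - trpi x. Proof. exact: raddfN. Qed.

Lemma pv_val n u : rank u = n -> pv u = val_phi n (gen n) (@tr n) u.
Proof. exact: pvE. Qed.

Lemma rank_cat u v : rank (u ++ v) = (rank u + rank v)%N.
Proof. by rewrite /rank dcat_cat size_cat. Qed.

Lemma rank_Ew d : rank (Ew d) = size d.
Proof. by rewrite /rank dcat_Ew. Qed.

Lemma size_dshift d i : (0 < i < size d)%N -> size (dshift d i) = size d.
Proof.
by case/split_pair=> D1 [k [l [D2 [-> <-]]]]; rewrite dshift_cat !size_cat.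
Qed.

Lemma pv_rel1 a b d i : (0 < i < size d)%N ->
  \sum_(p <- sandwich a (rel1 d i) b) pv p.2 *~ p.1 = 0.
Proof.
move=> li; set n := (rank a + size d + rank b)%N.
have di : (size (take i d) + size (drop i d) = size d)%N.
  by rewrite -size_cat cat_take_drop.
have := val_rel1 (@gen_satisfies n) (@trC n) li (erefl n : (rank a + size d + rank b)%N = n).
rewrite -!pv_val ?rank_cat ?rank_Ew ?size_dshift ?di ?[rank q1w]/0%N ?[rank q2w]/0%N
  ?add0n ?addnA // => E.
rewrite /sandwich /rel1 /= !big_cons big_nil /= addr0 !mulrNz !mulr1z.
by rewrite addrA [X in X + _]E addrACA subrr addNr addr0.
Qed.

Lemma pv_rel2 a b k d : (0 < size d)%N ->
  \sum_(p <- sandwich a (rel2 k d) b) pv p.2 *~ p.1 = 0.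
Proof.
move=> d0; set n := (rank a + (size d).+1 + rank b)%N.
have := val_rel2 (@gen_satisfies n) (@trC n) k d0
  (erefl n : (rank a + (size d).+1 + rank b)%N = n).
rewrite -![val_phi _ _ _ (a ++ (_ :: _) ++ b)]pv_val; last first.
  by rewrite !rank_cat /rank /= dcat_Ew /n addnA.
rewrite -![val_phi _ _ _ (a ++ (_ ++ [:: _]) ++ b)]pv_val; last first.
  have r1 : rank [:: E k [::]] = 1%N by [].
  by rewrite !rank_cat rank_Ew /n r1 addn1 addnA.
move=> E; rewrite big_map !big_cons mulrNz !mulr1z addrA [X in X + _]E.
rewrite [X in _ + X]big_flatten big_map -big_split big_seq big1 // => p.
case/flattenP=> c /mapP[j]; rewrite mem_iota => /andP[_ ljd] -> /(size_cterms ljd) sp.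
rewrite !big_cons big_nil -!pv_val.
- by rewrite /= addr0 mulrNz mulrzBl addrACA subrr addNr addr0.
- by rewrite !rank_cat rank_Ew sp addnA.
- by rewrite !rank_cat rank_Ew sp addnA.
Qed.

Lemma pv_letters a b u u' : dcat u = dcat u' -> (forall o, jpart o u = jpart o u') ->
  (forall (A : pzRingType) n (ev : BG -> A), satisfies n ev ->
     evw ev (qpart u) = evw ev (qpart u')) ->
  \sum_(p <- sandwich a (fdiff u u') b) pv p.2 *~ p.1 = 0.
Proof.
move=> Ed Ej Eq; rewrite !big_cons big_nil /= addr0 mulrNz !mulr1z.
apply/eqP; rewrite subr_eq0; apply/eqP; apply: pv_eq => [||A n ev evR].
- by rewrite !dcat_cat Ed.
- by rewrite !jpart_cat Ej /rank Ed.
- by rewrite !qpart_cat !evw_cat (Eq _ _ _ evR).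
Qed.

Lemma pv_RelA a r b : RelA r -> \sum_(p <- sandwich a r b) pv p.2 *~ p.1 = 0.
Proof.
case=> [[d [i [li ->]]]|[[k [d [d0 ->]]]|[[x ->]|[[x ->]|[->|->]]]]].
- exact: pv_rel1.
- exact: pv_rel2.
- apply: pv_letters => [|o|A n ev evR]; [by case: x | by case: x |].
  rewrite (qpart_cat [:: Qa] [:: x]) (qpart_cat [:: x] [:: Qa]) !evw_cat.
  by rewrite evw_cons evw_nil mulr1; exact: q_qpart evR [:: x].
- apply: pv_letters => [|o|A n ev evR]; [by case: x | by case: x |].
  rewrite (qpart_cat [:: Qai] [:: x]) (qpart_cat [:: x] [:: Qai]) !evw_cat.
  by rewrite evw_cons evw_nil mulr1; exact: qi_qpart evR [:: x].
- apply: pv_letters => // A n ev evR; rewrite !evw_cons evw_nil mulr1.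
  exact: qK evR.
- apply: pv_letters => // A n ev evR; rewrite !evw_cons evw_nil mulr1.
  exact: Kq evR.
Qed.

(** * Blocks, the homomorphism and its surjectivity *)

Definition blocks (bs : seq (int * seq int)) : seq AG := [seq E p.1 p.2 | p <- bs].

Lemma qpart_blocks bs : exists e, qpart (blocks bs) = nseq e Qbi.
Proof.
elim: bs => [|[d0 ds] bs [e IH]]; first by exists 0%N.
by exists (size ds + e)%N; rewrite /= IH nseqD.
Qed.

(** An increasing [J] encodes a composition: strands j and j + 1 share a block exactly when j lies
    in [J]. The induction decides whether the first strand joins the next block or stands alone. *)
Lemma blocks_exist o D J : sorted ltn J ->
  all (fun j => o < j < o + size D)%N J ->
  exists bs, dcat (blocks bs) = D /\ jpart o (blocks bs) = J.
Proof.
elim: D o J => [|d D IH] o J sJ oJ.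
  by exists [::]; case: J sJ oJ => //= j J _; lia.
case: J sJ oJ => [|j J] sJ oJ; last case: (eqVneq j o.+1) => [je|jo].
- have [bs [uD uJ]] := IH o.+1 [::] isT isT.
  by exists ((d, [::]) :: bs); split=> /=; rewrite ?uD ?addn1.
- case/andP: oJ => oj oJ; have sJ' : sorted ltn J by exact: path_sorted sJ.
  have jJ : all (ltn j) J.
    by move: sJ; rewrite /= path_sortedE; [case/andP | exact: ltn_trans].
  have [|bs [uD uJ]] := IH o.+1 J sJ'.
    by apply/allP=> i iJ; move: (allP oJ i iJ) (allP jJ i iJ) => /=; lia.
  (* Since o + 1 belongs to [J], a further strand exists, so there is a first block to which the
     strand o + 1 can be glued. *)
  case: bs uD uJ => [|[d' ds] bs] /= uD uJ; first by move: oj; rewrite -uD /=; lia.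
  exists ((d, d' :: ds) :: bs); split; rewrite /= ?uD //.
  by rewrite je -uJ addSnnS.
- have [|bs [uD uJ]] := IH o.+1 (j :: J) sJ.
    have jJ : all (leq j) (j :: J).
      rewrite /= leqnn /=; move: sJ; rewrite /= path_sortedE; last exact: ltn_trans.
      by case/andP=> sJ _; apply: sub_all sJ => i; exact: ltnW.
    apply/allP=> i iJ; have := allP jJ i iJ; have := allP oJ i iJ.
    by have := allP oJ j (mem_head _ _) => /=; lia.
  by exists ((d, [::]) :: bs); split=> /=; rewrite ?uD ?addn1.
Qed.

Definition Phi (x : FA) : FB := linext (fun u => wB (rank u) (phi u)) x.
HB.instance Definition _ := GRing.isZmodMorphism.Build FA FB Phi
  (@linext_is_zmod_morphism _ _ _).

Lemma Phi0 : Phi 0 = 0. Proof. exact: raddf0. Qed.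
Lemma PhiB x x' : Phi (x - x') = Phi x - Phi x'. Proof. exact: raddfB. Qed.

Lemma PhiD x x' : Phi (x + x') = Phi x + Phi x'. Proof. exact: raddfD. Qed.
Lemma PhiN x : Phi (- x) = - Phi x. Proof. exact: raddfN. Qed.

Lemma PhiE x : trpi (Phi x) = linext pv x.
Proof.
rewrite /Phi /linext raddf_sum; apply: eq_bigr => u _.
exact: raddfMz.
Qed.

Lemma PhiU u : Phi (wA u) = wB (rank u) (phi u).
Proof. by rewrite /Phi linextU mulr1z. Qed.

Lemma Phi_eqA x x' : eqA x x' -> eqB (Phi x) (Phi x').
Proof.
move=> xx'; apply/trpiP/eqP; rewrite -subr_eq0 !PhiE -linextB; apply/eqP; move: xx'.
apply: (zspan_ind (P := fun u => linext pv u = 0)) => [|u u' Eu Eu'|_ [a [r [b [Rr ->]]]]].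
- exact: linext0.
- by rewrite linextB Eu Eu' subr0.
rewrite /lcA raddf_sum -[RHS](pv_RelA a b Rr); apply: eq_bigr => p _.
exact: linextU.
Qed.

(** Written as nested [linext], the sums over supports become additive in each argument. Induction
    then reduces the claim to two words, where [skein_phi] applies. *)
Lemma Phi_prod x x' : eqB (Phi (prodA x x')) (prodB (Phi x) (Phi x')).
Proof.
apply/trpiP; transitivity (linext (fun u => linext (fun v => pv (u ++ v)) x') x).
  rewrite PhiE /prodA raddf_sum; apply: eq_bigr => u _; rewrite raddf_sum mulrz_suml.
  by apply: eq_bigr => v _; rewrite /= linextU mulrC mulrzA.
transitivity (linext (fun s => linext (fun s' => trpi (skeinW s s')) (Phi x')) (Phi x)).
  elim/malg_ind: x => [|u u' IHu IHu'|u]; first by rewrite Phi0 !linext0.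
    by rewrite PhiB !linextB IHu IHu'.
  rewrite -/(wA u) PhiU /wA /wB !linextU !mulr1z.
  elim/malg_ind: x' => [|v v' IHv IHv'|v]; first by rewrite Phi0 !linext0.
    by rewrite PhiB !linextB IHv IHv'.
  by rewrite -/(wA v) PhiU /wA /wB !linextU !mulr1z skein_phi.
rewrite /prodB [in RHS]raddf_sum; apply: eq_bigr => s _; rewrite [RHS]raddf_sum {1}/linext mulrz_suml.
by apply: eq_bigr => s' _; rewrite -mulrzA mulrC; exact/esym/raddfMz.
Qed.

Lemma tr_blocks n D J e f : size D = n -> sorted ltn J ->
  all (fun j => 0 < j < n)%N J ->
  exists u, pv u = tr (gen n Qb ^+ e * gen n Qbi ^+ f * (Ys n (gen n) 0 D * tw (gen n) J)).
Proof.
move=> sD sJ vJ; have [|bs [bD bJ]] := @blocks_exist 0 D J sJ; first by rewrite sD.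
have [g gE] := qpart_blocks bs.
(* The blocks bring their own factor q^-g; the letters [nseq g Qa] cancel it. *)
exists (nseq e Qa ++ nseq f Qai ++ nseq g Qa ++ blocks bs).
have dQ m : dcat (nseq m Qa) = [::] /\ dcat (nseq m Qai) = [::] by elim: m.
have jQ o m : jpart o (nseq m Qa) = [::] /\ jpart o (nseq m Qai) = [::] by elim: m.
have qQ m : qpart (nseq m Qa) = nseq m Qb /\ qpart (nseq m Qai) = nseq m Qbi.
  by elim: m => //= m [-> ->].
have dE : dcat (nseq e Qa ++ nseq f Qai ++ nseq g Qa ++ blocks bs) = D.
  by rewrite !dcat_cat !(dQ _).1 (dQ _).2.
rewrite (pvE (n := n)); last by rewrite /rank dE.
rewrite dE !jpart_cat !qpart_cat /rank !(dQ _).1 !(dQ _).2 !(jQ _ _).1 !(jQ _ _).2 /=.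
rewrite !addn0 bJ !(qQ _).1 (qQ _).2 gE !evw_cat !evw_nseq -mulrA.
by rewrite (qXK (@gen_satisfies n)) mulr1.
Qed.

Lemma Phi_surj y : exists x, eqB (Phi x) y.
Proof.
suff [x xE] : exists x, trpi (Phi x) = trpi y by exists x; apply/trpiP.
elim/malg_ind: y => [|y y' [x xE] [x' xE']|[n w]].
- by exists 0; rewrite Phi0.
- by exists (x - x'); rewrite PhiB !trpiB xE xE'.
(* A word with letters outside AH_n has class 0, the image of 0. *)
case: (boolP (valid n w)) => vw; last first.
  exists 0; rewrite Phi0; apply/esym/trpiP; rewrite /eqB subr0.
  by apply: zspan_gen; left; exists n, w.
pose Im v := exists x, trpi (Phi x) = v.
suff: Im (tr (evw (gen n) w)) by rewrite tr_evw.
apply: (trace_span (@gen_satisfies n) (@trC n)) vw.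
- by exists 0; rewrite Phi0 raddf0.
- by move=> _ _ [x <-] [x' <-]; exists (x + x'); rewrite PhiD trpiD.
- by move=> _ [x <-]; exists (- x); rewrite PhiN trpiN.
- move=> e f D J sD sJ vJ; have [u uE] := tr_blocks e f sD sJ vJ.
  by exists (wA u); rewrite PhiU.
Qed.

Theorem theorem5 :
  exists Phi : FA -> FB,
    [/\ (forall x y, eqA x y -> eqB (Phi x) (Phi y)),
        (forall x y, eqB (Phi (x + y)) (Phi x + Phi y)),
        (forall x y, eqB (Phi (prodA x y)) (prodB (Phi x) (Phi y))),
        eqB (Phi oneA) oneB &
        eqB (Phi (wA [:: Qa])) (wB 0 [:: Qb])]
    /\ (forall (d0 : int) (ds : seq int),
          eqB (Phi (wA [:: E d0 ds])) (eB (d0 :: ds)))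
    /\ (forall y : FB, exists x : FA, eqB (Phi x) y).
Proof.
exists Phi; split; [split | split].
- exact: Phi_eqA.
- by move=> x y; apply/trpiP; rewrite PhiD.
- exact: Phi_prod.
- by apply/trpiP; rewrite /oneA PhiU.
- by apply/trpiP; rewrite PhiU.
- move=> d0 ds; apply/trpiP; rewrite PhiU /eB /eword /phi /ypart /rank /=.
  by rewrite !cats0.
- exact: Phi_surj.
Qed.
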